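(* Let $V$ be a lightlike hypersurface of an $n$-dimensional pseudo-Riemannian manifold $(M,g)$ of Lorentzian signature, and let $J=J(x)$ be an absolute invariant defined on $V$ whose level $(n-2)$-dimensional submanifolds are transversal to the isotropic geodesics of $V$. Then: (1) the distribution $S$ tangent to these level submanifolds is an invariant screen distribution on $V$; (2) if the invariant $J$ is connected with $V$ intrinsically, then the same is true for the screen distribution $S$ generated by $J$; (3) if the order of the invariant $J$ is equal to $p$, then the normalization defined by $S$ is defined in a neighborhood of a point $x\in V$ of order $p+1$, and the curvature tensor of the affine connection it induces on $V$ is defined in a neighborhood of $x\in V$ of order $p+2$.
   Context: $(M,g)$ has signature $(n-1,1)$, with Levi-Civita connection $D$. A lightlike hypersurface $V$ is a hypersurface ($\dim V=n-1$) on which $g$ has rank $n-2$. A first-order isotropic frame at $x\in V$ is a basis $(e_1,\dots,e_n)$ of $T_xM$ with $e_1$ isotropic, $T_xV=\mathrm{span}(e_1,\dots,e_{n-1})$, $e_a$ ($a=2,\dots,n-1$) spacelike and orthogonal to $e_1$, $g_{ab}=(e_a,e_b)$ positive definite, $e_n$ isotropic, $(e_1,e_n)=-1$, $(e_a,e_n)=0$. The integral curves of the isotropic direction field $e_1$ on $V$ are its isotropic geodesics. A screen subspace $S_x\subset T_xV$ is an $(n-2)$-dimensional subspace complementary to the isotropic direction $\mathbb{R}e_1$; a screen distribution is a smooth field $S=\bigcup_xS_x$ of such subspaces. It is invariant if $S_x$ does not depend on the choice of first-order isotropic frame at $x$. A screen distribution is equivalent to a normalization of $V$: $N_x$ is the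 unique isotropic direction orthogonal to $S_x$ and not contained in $T_xV$. It induces an affine connection on $V$: for tangent fields $X,Y$ of $V$, the derivative is the projection of $D_XY$ onto $T_xV$ along $N_x$. An absolute invariant $J$ of $V$ is a function on $V$ whose value at $x$ is independent of the choice of first-order isotropic frame at $x$ ($\delta J=0$, where $\delta$ is differentiation with respect to fiber parameters). An object on $V$ is intrinsically connected with $V$ if it is determined by $(M,g)$ and $V$ alone, without auxiliary choices (coordinates, frames, vector fields). An object is defined in an order-$p$ neighborhood of $x$ (has order $p$) if its value at $x$ depends on the differential neighborhood of order $p$ of $x$; in the counting used, the components $g_{ij}$ are of first order, the Levi-Civita connection forms $\omega^i_j$ and the second fundamental tensor of $V$ are of second order, and the curvature tensor of $(M,g)$ is of third order (i.e. order $p$ involves the $p$-jet of $V$ and the $(p-1)$-jet of $g$ at $x$), and each further differentiation raises the order by one. *)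

(* Defs.v *)
From HB Require Import structures.
From mathcomp Require Import all_boot all_order all_algebra.
From mathcomp Require Import all_classical all_reals all_analysis.
Set Implicit Arguments.
Unset Strict Implicit.
Unset Printing Implicit Defensive.
Import Order.TTheory GRing.Theory Num.Theory.
Import numFieldNormedType.Exports.
Local Open Scope classical_set_scope.
Local Open Scope ring_scope.

(* Vectors are rows: the differential of [f] at [u] sends [v] to
   [v *m 'J f u], and a bilinear form with Gram matrix [G] is [a G b^T]. *)

Section Smooth.
Context {R : realType} {E F : normedModType R}.

(* On an open set this is the class C^oo: every iterated directional
   derivative exists and is Frechet differentiable. *)
Definition smooth_on (U : set E) (f : E -> F) : Prop :=
  forall (vs : seq E) (u : E), U u ->
    differentiable (foldr (fun v (h : E -> F) => 'D_v h) f vs) u.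

Definition smooth_at (u : E) (f : E -> F) : Prop :=
  exists U : set E, [/\ open U, U u & smooth_on U f].

End Smooth.

Section Manifolds.
Context {R : realType}.

(* [fwd] and [bwd] are total; only their values on [dom] and [cod] matter. *)
Record chart (M : topologicalType) (n : nat) := Chart {
  dom : set M;
  fwd : M -> 'rV[R]_n;
  bwd : 'rV[R]_n -> M }.

Definition cod M n (c : chart M n) : set 'rV[R]_n := fwd c @` dom c.

Definition is_chart M n (c : chart M n) : Prop :=
  [/\ open (dom c), open (cod c),
      (forall x, dom c x -> {for x, continuous (fwd c)}),
      (forall u, cod c u -> {for u, continuous (bwd c)}) &
      (forall x, dom c x -> bwd c (fwd c x) = x)].

Section LocalRepresentative.
Context {M M' : topologicalType} {n n' : nat}.

Definition overlap (c : chart M n) (d : chart M' n') (f : M -> M')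
  : set 'rV[R]_n := fwd c @` (dom c `&` f @^-1` dom d).

Definition loc (c : chart M n) (d : chart M' n') (f : M -> M')
  : 'rV[R]_n -> 'rV[R]_n' := fun u => fwd d (f (bwd c u)).

Definition jac (c : chart M n) (d : chart M' n') (f : M -> M') (x : M)
  : 'M[R]_(n, n') := 'J (loc c d f) (fwd c x).

End LocalRepresentative.

Definition compatible M n (c c' : chart M n) : Prop :=
  smooth_on (overlap c c' id) (loc c c' id).

Record manifold (n : nat) := Manifold {
  points :> topologicalType;
  atlas : set (chart points n);
  points_hausdorff : hausdorff_space points;
  points_second_countable : @second_countable points;
  atlas_chart : forall c, atlas c -> is_chart c;
  atlas_cover : forall x : points, exists2 c, atlas c & dom c x;
  atlas_compatible : forall c c', atlas c -> atlas c' -> compatible c c';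
  atlas_maximal : forall c, is_chart c ->
    (forall c', atlas c' -> compatible c c' /\ compatible c' c) -> atlas c }.

Definition mchart n (M : manifold n) := chart M n.

Definition smooth_map n n' (M : manifold n) (M' : manifold n') (f : M -> M')
  : Prop :=
  continuous f /\
  forall c d, atlas c -> atlas d -> smooth_on (overlap c d f) (loc c d f).

Definition diffeomorphism n (M M' : manifold n) (f : M -> M') : Prop :=
  smooth_map f /\
  exists h : M' -> M, [/\ cancel f h, cancel h f & smooth_map h].

Definition smooth_function n (M : manifold n) (f : M -> R) : Prop :=
  forall c, atlas c -> smooth_on (cod c) (f \o bwd c).

Definition bil n (G : 'M[R]_n) (a b : 'rV[R]_n) : R := (a *m G *m b^T) 0 0.

End Manifolds.

Arguments manifold R n : clear implicits.

Section Lightlike.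
Context {R : realType} {m : nat}.

(* The ambient dimension is n = m + 2, so that n - 2 = m; [gram d x] is the
   matrix of the metric at [x] in the coordinates [d]. *)
Definition lorentz_diag : 'M[R]_m.+2 :=
  diag_mx (\row_i (if i == ord_max then -1 else 1)).

Record lorentz_metric (M : manifold R m.+2) := LorentzMetric {
  gram : mchart M -> M -> 'M[R]_m.+2;
  gram_smooth : forall d, atlas d -> smooth_on (cod d) (gram d \o bwd d);
  gram_sym : forall d x, atlas d -> dom d x -> (gram d x)^T = gram d x;
  gram_signature : forall d x, atlas d -> dom d x ->
    exists2 P : 'M[R]_m.+2, P \in unitmx &
      P *m gram d x *m P^T = lorentz_diag;
  gram_change : forall d d' x, atlas d -> atlas d' -> dom d x -> dom d' x ->
    gram d x = jac d d' id x *m gram d' x *m (jac d d' id x)^T }.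

(* A hypersurface is an immersed manifold of dimension n - 1; embedded ones
   are the case where [incl] is a homeomorphism onto its image. *)
Record lightlike (M : manifold R m.+2) (g : lorentz_metric M) := Lightlike {
  surf :> manifold R m.+1;
  incl : surf -> M;
  incl_smooth : smooth_map incl;
  incl_immersion : forall c d x, atlas c -> atlas d -> dom c x ->
    dom d (incl x) -> \rank (jac c d incl x) = m.+1;
  incl_lightlike : forall c d x, atlas c -> atlas d -> dom c x ->
    dom d (incl x) ->
    \rank (jac c d incl x *m gram g d (incl x) *m (jac c d incl x)^T) = m }.

Section OneHypersurface.
Context {M : manifold R m.+2} {g : lorentz_metric M} (V : lightlike g).

(* [w] is the component row, in the chart [c] of [V], of a vector of T_x V. *)
Definition isotropic (c : mchart V) (x : V) (w : 'rV[R]_m.+1) : Prop :=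
  w != 0 /\
  forall d, atlas d -> dom d (incl x) ->
    bil (gram g d (incl x)) (w *m jac c d (@incl _ _ V) x)
                            (w *m jac c d (@incl _ _ V) x) = 0.

(* (d, E): the i-th row of [E] holds the components of the i-th frame vector
   in the chart [d] of [M]; [ord0] and [ord_max] are the indices 1 and n. *)
Definition frame : Type := (mchart M * 'M[R]_m.+2)%type.

Definition first_order_frame (x : V) (fr : frame) : Prop :=
  let: (d, E) := fr in
  let H := E *m gram g d (incl x) *m E^T in
  [/\ atlas d, dom d (incl x) & E \in unitmx] /\
  [/\ (forall c, atlas c -> dom c x ->
         (row' ord_max E == jac c d (@incl _ _ V) x)%MS),
      [/\ H ord0 ord0 = 0, H ord_max ord_max = 0 & H ord0 ord_max = -1],
      (forall a, a != ord0 -> a != ord_max ->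
         H ord0 a = 0 /\ H a ord_max = 0) &
      (forall v : 'rV[R]_m.+2, v 0 ord0 = 0 -> v 0 ord_max = 0 -> v != 0 ->
         0 < bil H v v)].

Definition frame_field (e : V -> frame) : Prop :=
  forall x, first_order_frame x (e x).

(* A field of subsets of the tangent spaces of [V], given by components in
   each chart of [V]. *)
Definition distribution : Type := mchart V -> V -> set 'rV[R]_m.+1.

(* Velocities at [x] of the smooth curves through [x] lying in the level set
   of [f] through [x]. *)
Definition level_distribution (f : V -> R) : distribution :=
  fun c x => [set w | exists gam : R -> V,
    [/\ gam 0 = x,
        (\forall t \near (0 : R), dom c (gam t) /\ f (gam t) = f x),
        smooth_at (0 : R) (fwd c \o gam) &
        derive1 (fwd c \o gam) 0 = w]].

Definition regular_levels (f : V -> R) : Prop :=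
  forall c x, atlas c -> dom c x ->
    exists w, 'D_w (f \o bwd c) (fwd c x) != 0.

(* T_x V is the sum of the tangent space of the level set and the line tangent
   to the isotropic geodesic through [x]. *)
Definition transversal_levels (f : V -> R) : Prop :=
  forall c x w, atlas c -> dom c x -> isotropic c x w ->
    forall v, exists2 s, level_distribution f c x s & exists k, v = s + k *: w.

Definition screen_subspace (c : mchart V) (x : V) (S : set 'rV[R]_m.+1)
  : Prop :=
  exists B : 'M[R]_(m, m.+1),
    [/\ \rank B = m, S = [set w | (w <= B)%MS] &
        forall w, isotropic c x w -> ~~ (w <= B)%MS].

Definition smooth_distribution (S : distribution) : Prop :=
  forall c x, atlas c -> dom c x ->
    exists B : 'rV[R]_m.+1 -> 'M[R]_(m, m.+1),
      smooth_at (fwd c x) B /\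
      \forall u \near fwd c x,
        \rank (B u) = m /\ S c (bwd c u) = [set w | (w <= B u)%MS].

Definition screen_distribution (S : distribution) : Prop :=
  smooth_distribution S /\
  forall c x, atlas c -> dom c x -> screen_subspace c x (S c x).

(* The isotropic line N_x together with 0, in the coordinates [d] of [M]. *)
Definition normalization (S : distribution) (c : mchart V) (d : mchart M)
    (x : V) : set 'rV[R]_m.+2 :=
  let G := gram g d (incl x) in
  let A := jac c d (@incl _ _ V) x in
  [set v | [/\ bil G v v = 0,
               (forall w, S c x w -> bil G v (w *m A) = 0) &
               ((v <= A)%MS -> v = 0)]].

(* Christoffel formula: [christoffel d y a b] has components
   Gamma^k_ij a^i b^j at the point of coordinates [y]. *)
Definition christoffel (d : mchart M) (y : 'rV[R]_m.+2) (a b : 'rV[R]_m.+2)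
  : 'rV[R]_m.+2 :=
  let G := gram g d \o bwd d in
  (\row_k (2^-1 * (bil ('D_a G y) b (delta_mx 0 k)
                   + bil ('D_b G y) a (delta_mx 0 k)
                   - bil ('D_(delta_mx 0 k) G y) a b))) *m invmx (G y).

Definition vfield : Type := 'rV[R]_m.+1 -> 'rV[R]_m.+1.

(* D_X Y along [V], for fields [X], [Y] of [V] read in the chart [c]. *)
Definition levi_civita (c : mchart V) (d : mchart M) (X Y : vfield)
    (u : 'rV[R]_m.+1) : 'rV[R]_m.+2 :=
  let phi := loc c d (@incl _ _ V) in
  'D_(X u) (fun u' => Y u' *m 'J phi u') u
  + christoffel d (phi u) (X u *m 'J phi u) (Y u *m 'J phi u).

(* The tangential part of D_X Y in the decomposition T_x M = T_x V + N_x. *)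
Definition induced_connection (S : distribution) (c : mchart V) (d : mchart M)
    (X Y : vfield) : vfield :=
  fun u => xget 0 [set t |
    normalization S c d (bwd c u)
      (levi_civita c d X Y u - t *m 'J (loc c d (@incl _ _ V)) u)].

Definition lie_bracket (X Y : vfield) : vfield :=
  fun u => 'D_(X u) Y u - 'D_(Y u) X u.

Definition curvature (nabla : vfield -> vfield -> vfield) (X Y Z : vfield)
  : vfield :=
  fun u => nabla X (nabla Y Z) u - nabla Y (nabla X Z) u
           - nabla (lie_bracket X Y) Z u.

Definition coord_field (i : 'I_m.+1) : vfield := fun=> delta_mx 0 i.

End OneHypersurface.

(* An isomorphism of triples (M, g, V) -> (M', g', V'). *)
Definition isometric_pair (M M' : manifold R m.+2) (g : lorentz_metric M)
    (g' : lorentz_metric M') (V : lightlike g) (V' : lightlike g')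
    (Phi : M -> M') (psi : V -> V') : Prop :=
  [/\ diffeomorphism Phi, diffeomorphism psi,
      (forall x, Phi (incl x) = incl (psi x)) &
      (forall d d' y, atlas d -> atlas d' -> dom d y -> dom d' (Phi y) ->
         gram g d y =
         jac d d' Phi y *m gram g' d' (Phi y) *m (jac d d' Phi y)^T)].

(* Jets of order <= q as the table of iterated partial derivatives indexed by
   words of length q over {identity} + {d/du_i}; lower-order derivatives and
   reorderings of the same derivative appear repeatedly. *)
Definition jet_index (k q : nat) : finType := {: q.-tuple (option 'I_k)}.

Definition jet (k l q : nat) (f : 'rV[R]_k -> 'rV[R]_l) (u : 'rV[R]_k)
  : 'M[R]_(#|jet_index k q|, l) :=
  \matrix_(i, j)
    foldr (fun o (h : 'rV[R]_k -> 'rV[R]_l) =>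
             if o is Some a then 'D_(delta_mx 0 a) h else h)
          f (tval (enum_val i)) u 0 j.

Definition jet_space (q : nat) : normedModType R :=
  ('M[R]_(#|jet_index m.+1 q|, m.+2)
   * 'M[R]_(#|jet_index m.+2 q.-1|, m.+2 * m.+2))%type.

(* The q-jet of [V] (through the parametrization inverse to [c]) and the
   (q-1)-jet of the metric, at [x]. *)
Definition jets (M : manifold R m.+2) (g : lorentz_metric M) (V : lightlike g)
    (c : mchart V) (d : mchart M) (q : nat) (x : V) : jet_space q :=
  (jet q (loc c d (@incl _ _ V)) (fwd c x),
   jet q.-1 (fun y => mxvec (gram g d (bwd d y))) (fwd d (incl x))).

(* A rule is a construction performed on every lightlike hypersurface; [K]
   singles out those on which the rule is considered. *)
Definition hypersurface_class : Type :=
  forall (M : manifold R m.+2) (g : lorentz_metric M), lightlike g -> Prop.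

Definition frame_function : Type :=
  forall (M : manifold R m.+2) (g : lorentz_metric M) (V : lightlike g),
    V -> @frame M -> R.

Definition along (J : frame_function) (M : manifold R m.+2)
    (g : lorentz_metric M) (V : lightlike g) (e : V -> @frame M) : V -> R :=
  fun x => J M g V x (e x).

Definition absolute_invariant (K : hypersurface_class) (J : frame_function)
  : Prop :=
  forall M g (V : lightlike g), K M g V -> forall x fr fr',
    first_order_frame (V := V) x fr -> first_order_frame (V := V) x fr' ->
    J M g V x fr = J M g V x fr'.

(* A distribution constructed with the help of a frame field. *)
Definition frame_distribution : Type :=
  forall (M : manifold R m.+2) (g : lorentz_metric M) (V : lightlike g),
    (V -> @frame M) -> distribution V.

Definition generated (J : frame_function) : frame_distribution :=
  fun M g V e => level_distribution (along J e).

Definition invariant_distribution (K : hypersurface_class)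
    (S : frame_distribution) : Prop :=
  forall M g (V : lightlike g), K M g V -> forall e e' : V -> @frame M,
    frame_field e -> frame_field e' ->
    forall c x, atlas c -> dom c x -> S M g V e c x = S M g V e' c x.

(* Determined by (M, g) and V alone: the rule commutes with all
   isomorphisms of triples, whatever frames are used to evaluate it. *)
Definition intrinsic_function (K : hypersurface_class) (J : frame_function)
  : Prop :=
  forall M g (V : lightlike g) M' g' (V' : lightlike g') Phi psi,
    K M g V -> K M' g' V' -> isometric_pair (V := V) (V' := V') Phi psi ->
    forall x fr fr', first_order_frame (V := V) x fr ->
      first_order_frame (V := V') (psi x) fr' ->
      J M' g' V' (psi x) fr' = J M g V x fr.

Definition intrinsic_distribution (K : hypersurface_class)
    (S : frame_distribution) : Prop :=
  forall M g (V : lightlike g) M' g' (V' : lightlike g') Phi psi,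
    K M g V -> K M' g' V' -> isometric_pair (V := V) (V' := V') Phi psi ->
    forall e e', frame_field (V := V) e -> frame_field (V := V') e' ->
    forall c c' x, atlas c -> atlas c' -> dom c x -> dom c' (psi x) ->
      S M' g' V' e' c' (psi x) =
      (fun w => w *m jac c c' psi x) @` S M g V e c x.

(* [Q c d x a] means that the object at [x] has components [a] in the charts [c]
   of V and [d] of M.  The object is defined in a neighborhood of order [q]
   when its components are one smooth function [F] of the jets of V and g, the
   same for all metrics on M and all hypersurfaces of M in the class. *)
Definition has_order (K : hypersurface_class) (q : nat) (W : normedModType R)
    (Q : forall (M : manifold R m.+2) (g : lorentz_metric M) (V : lightlike g),
           mchart V -> mchart M -> V -> W -> Prop) : Prop :=
  forall (M : manifold R m.+2) (d : mchart M), atlas d ->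
  exists F : jet_space q -> W,
  forall (g : lorentz_metric M) (V : lightlike g), K M g V ->
  forall c x, atlas c -> dom c x -> dom d (incl x) ->
    smooth_at (jets (V := V) c d q x) F /\
    Q M g V c d x (F (jets (V := V) c d q x)).

Definition function_order K q (J : frame_function) : Prop :=
  has_order K q (fun M g V c d x (a : R) =>
    forall fr, first_order_frame (V := V) x fr -> J M g V x fr = a).

Definition normalization_order K q (S : frame_distribution) : Prop :=
  has_order K q (fun M g V c d x (a : 'rV[R]_m.+2) =>
    forall e, frame_field (V := V) e ->
      a != 0 /\
      normalization (S M g V e) c d x = range (fun k : R => k *: a)).

Definition curvature_order K q (S : frame_distribution) : Prop :=
  forall i j k : 'I_m.+1,
  has_order K q (fun M g V c d x (a : 'rV[R]_m.+1) =>
    forall e, frame_field (V := V) e ->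
      curvature (induced_connection (S M g V e) c d)
        (coord_field i) (coord_field j) (coord_field k) (fwd c x) = a).

End Lightlike.

Arguments hypersurface_class R m : clear implicits.
Arguments frame_function R m : clear implicits.

(* Main.v *)
From HB Require Import structures.
From mathcomp Require Import all_boot all_order all_algebra.
From mathcomp Require Import all_classical all_reals all_analysis.
From mathcomp Require Import ring lra.
Require Import Defs.

(** Write [j] for the differential of the invariant [f] at [x], a covector on
    the tangent space of the hypersurface, and let [A] be the matrix of the
    differential of the embedding and [G] that of the metric.

    The tangent space of a level set is the kernel of [j].  Velocities of curves
    in a level set are killed by [j] by the chain rule; conversely, transversality
    writes a vector [v] as [s + k w] with [s] such a velocity and [w] isotropic,
    and [j w <> 0] (otherwise [j] would vanish identically, against regularity),
    so that [k = 0] as soon as [j v = 0].  No implicit function theorem is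
    involved ([level_distributionE]).  Hence the distribution is a smooth field of
    hyperplanes missing the isotropic line, that is, a screen; it depends on
    the frames only through the values of [f], and an isomorphism preserving the
    invariant carries [j], hence its kernel, to the corresponding object
    ([level_distribution_image]).

    For the orders, everything is made rational in [A], [G] and [j].  The induced
    metric [H = A G A^T] has a one-dimensional kernel on which [j] does not
    vanish, so the bordered matrix [H + j j^T] is invertible and
    [j^T (H + j j^T)^-1] is the null vector on which [j] equals one.  Correcting
    a lift of [j] by a multiple of that null vector gives an isotropic vector
    spanning the normalization ([normal_vecP]), and the projection along it is
    again rational ([tangent_partP]).  The same formulas, applied to any covector
    nonzero on the null direction, produce first-order isotropic frames, so that
    the hypotheses on [f], which speak of frame fields, always apply
    ([exists_frame_field]).

    If [f] is a smooth function [F] of the jet of order [p], the chain rule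
    expresses the derivatives of [f] along the hypersurface as a smooth function
    of the jet of order [p.+1], the total derivative of [F] ([total_deriveP]).
    So [j], the normalization and the connection coefficients are smooth functions
    of the jet of order [p.+1], and one further total derivative gives the
    curvature as a smooth function of the jet of order [p.+2]. *)

Set Implicit Arguments.
Unset Strict Implicit.
Unset Printing Implicit Defensive.
Import Order.TTheory GRing.Theory Num.Theory.
Import numFieldNormedType.Exports.
Local Open Scope classical_set_scope.
Local Open Scope ring_scope.

(** * Smooth maps between normed spaces *)

Section SmoothCalculus.
Context {R : realType}.
Implicit Types E F : normedModType R.

(** Differentiability is local.  The differential is defined by a choice, so the
    affine approximation of [f] is first exhibited as one of [g]. *)
Lemma near_eq_differentiable E F (f g : E -> F) (u : E) :
  (\near u, f u = g u) -> differentiable f u -> differentiable g u.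
Proof.
move=> fg /diffP[dfc df]; apply/diffP.
apply: (@getPex _ (fun (dg : {linear E -> F}) => continuous dg /\
  forall y, g y = g (lim (nbhs u)) + dg (y - lim (nbhs u))
                  +o_(y \near u) (y - lim (nbhs u)))).
exists ('d f u); split=> //.
have /eqaddoP dfP : f = (fun y => f (lim (nbhs u)) + 'd f u (y - lim (nbhs u)))
    +o_u (fun y => y - lim (nbhs u)).
  by apply/funext => y; rewrite {1}df.
suff /eqaddoP dgP : forall e, 0 < e -> \forall y \near u,
    `|(g - (fun y => g (lim (nbhs u)) + 'd f u (y - lim (nbhs u)))) y| <=
    e * `|y - lim (nbhs u)|.
  by move=> y; rewrite {1}dgP.
move=> e e0; have := dfP _ e0; rewrite lim_id // => dfe.
have fgu := nbhs_singleton fg.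
near=> y.
have -> : (g - (fun y0 => g u + 'd f u (y0 - u))) y =
     (f - (fun y0 => f u + 'd f u (y0 - u))) y.
  by rewrite !fctE fgu; congr (_ - _); apply/esym; near: y.
by near: y.
Unshelve. all: by end_near.
Qed.

(** Smoothness cut at a finite order.  Product and quotient rules turn the
    derivative of a compound into an expression of the same kind with one
    derivative less to control, so closure properties go by induction on [k]. *)
Fixpoint differentiable_upto E F (k : nat) (U : set E) (f : E -> F) : Prop :=
  (forall u, U u -> differentiable f u) /\
  if k is k'.+1 then forall v, differentiable_upto k' U ('D_v f) else True.

Lemma smooth_onE E F (U : set E) (f : E -> F) :
  smooth_on U f <-> forall k, differentiable_upto k U f.
Proof.
split=> [sf k|df vs u Uu].
  elim: k f sf => [|k IH] f sf /=; (split; first exact: (sf [::])) => // v.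
  by apply: IH => vs u Uu; have := sf (rcons vs v) u Uu; rewrite foldr_rcons.
elim/last_ind: vs f df => [|vs v IH] f df /=; first by have [d0 _] := df 0%N; exact: d0.
by rewrite foldr_rcons; apply: IH => k; have [_] := df k.+1; apply.
Qed.

Lemma differentiable_uptoS E F k (U : set E) (f : E -> F) :
  differentiable_upto k.+1 U f -> differentiable_upto k U f.
Proof.
elim: k f => [|k IH] f [df Df]; split => // v.
by apply: IH; apply: Df.
Qed.

Lemma differentiable_upto_congr E F k (U : set E) (f g : E -> F) : open U ->
  (forall u, U u -> f u = g u) ->
  differentiable_upto k U f -> differentiable_upto k U g.
Proof.
move=> oU; have near_fg (f' g' : E -> F) : (forall u, U u -> f' u = g' u) ->
    forall u, U u -> \near u, f' u = g' u.
  by move=> fg u Uu; near=> x; apply: fg; near: x; apply: open_nbhs_nbhs.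
elim: k f g => [|k IH] f g fg [df Df];
  (split; first by move=> u Uu; apply: near_eq_differentiable (df u Uu); apply: near_fg) => //.
move=> v; apply: (IH _ _ _ (Df v)) => u Uu.
by apply: near_eq_derive; apply: near_fg.
Unshelve. all: by end_near.
Qed.

Section Closure.
Variables (E F : normedModType R) (U : set E).
Hypothesis oU : open U.

Lemma differentiable_upto_cst k (a : F) : differentiable_upto k U (fun _ : E => a).
Proof.
elim: k a => [|k IH] a; split=> //; try (by move=> u _; exact: differentiable_cst).
move=> v; rewrite (_ : 'D_v _ = fun=> 0) //.
by apply/funext => u; rewrite derive_cst.
Qed.

Lemma differentiable_upto_add k (f g : E -> F) : differentiable_upto k U f ->
  differentiable_upto k U g -> differentiable_upto k U (fun x => f x + g x).
Proof.
elim: k f g => [|k IH] f g [df Df] [dg Dg];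
  (split; first by move=> u Uu; apply: differentiableD; [apply: df|apply: dg]) => //.
move=> v; apply: (differentiable_upto_congr oU _ (IH _ _ (Df v) (Dg v))) => u Uu.
by apply/esym/deriveD; apply: diff_derivable; [apply: df|apply: dg].
Qed.

Lemma differentiable_upto_linear (G : normedModType R) (L : {linear F -> G}) k (f : E -> F) :
  continuous L -> differentiable_upto k U f ->
  differentiable_upto k U (fun x => L (f x)).
Proof.
move=> cL; elim: k f => [|k IH] f [df Df];
  (split; first by move=> u Uu; apply: differentiable_comp;
     [exact: df|exact: linear_differentiable]) => //.
move=> v; apply: (differentiable_upto_congr oU _ (IH _ (Df v))) => u Uu.
have dL := linear_differentiable (f u) cL.
rewrite !deriveE //; first by rewrite (diff_comp (df u Uu)) //= diff_lin.
- by apply: differentiable_comp => //; apply: df.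
- exact: df.
Qed.

End Closure.

Section Closure2.
Variables (E : normedModType R) (U : set E).
Hypothesis oU : open U.

Lemma differentiable_upto_mul k (f g : E -> R) : differentiable_upto k U f ->
  differentiable_upto k U g -> differentiable_upto k U (fun x => f x * g x).
Proof.
elim: k f g => [|k IH] f g sf sg; have [df Df] := sf; have [dg Dg] := sg;
  (split; first by move=> u Uu; apply: differentiableM; [apply: df|apply: dg]) => //.
move=> v.
have sum := differentiable_upto_add oU (IH _ _ (differentiable_uptoS sf) (Dg v))
  (IH _ _ (differentiable_uptoS sg) (Df v)).
apply: (differentiable_upto_congr oU _ sum) => u Uu.
by apply/esym/deriveM; apply: diff_derivable; [apply: df|apply: dg].
Qed.

Lemma differentiable_upto_inv k (f : E -> R) : (forall u, U u -> f u != 0) ->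
  differentiable_upto k U f -> differentiable_upto k U (fun x => (f x)^-1).
Proof.
move=> f0; elim: k f f0 => [|k IH] f f0 sf; have [df Df] := sf;
  (split; first by move=> u Uu; apply: differentiableV; [apply: df|apply: f0]) => //.
move=> v.
have si := IH _ f0 (differentiable_uptoS sf).
have sm1 := @differentiable_upto_cst E R U k (- 1 : R).
have := differentiable_upto_mul (differentiable_upto_mul si si)
  (differentiable_upto_mul sm1 (Df v)).
apply: differentiable_upto_congr => // u Uu.
rewrite deriveV; [|exact: f0|exact/diff_derivable/df].
by rewrite -[RHS]/(_ * _) -exprVn expr2 mulN1r mulrN mulNr.
Qed.

End Closure2.

Lemma smooth_on_derive E F (U : set E) (f : E -> F) v :
  smooth_on U f -> smooth_on U ('D_v f).
Proof. by move=> sf vs u Uu; have := sf (rcons vs v) u Uu; rewrite foldr_rcons. Qed.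

Lemma smooth_on_sub E F (U V : set E) (f : E -> F) :
  V `<=` U -> smooth_on U f -> smooth_on V f.
Proof. by move=> VU sf vs u /VU; apply: sf. Qed.

(** A linear change of variable turns derivation along [v] into derivation along
    [L v], so iterated derivatives are again of the same form. *)
Lemma foldr_derive_comp E F (G : normedModType R) (L : {linear E -> F})
    (U : set F) (f : F -> G) : open U -> continuous L -> smooth_on U f ->
  forall vs (u : E), U (L u) ->
     foldr (fun v (h : E -> G) => 'D_v h) (f \o L) vs u =
     foldr (fun v (h : F -> G) => 'D_v h) f (map L vs) (L u).
Proof.
move=> oU cL sf; elim=> [//|v vs IH] u Uu /=.
have oLU : open (L @^-1` U) by move/continuousP : cL; apply.
rewrite (near_eq_derive
  (g := foldr (fun v (h : F -> G) => 'D_v h) f (map L vs) \o L)); last first.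
  by near=> x; apply: IH; near: x; apply: open_nbhs_nbhs.
have dL := linear_differentiable u cL.
have dh := sf (map L vs) _ Uu.
rewrite !deriveE //; last exact: differentiable_comp.
by rewrite diff_comp //= diff_lin.
Unshelve. all: by end_near.
Qed.

Lemma smooth_on_comp_linear E F (G : normedModType R) (L : {linear E -> F})
    (U : set F) (f : F -> G) : open U -> continuous L -> smooth_on U f ->
  smooth_on (L @^-1` U) (f \o L).
Proof.
move=> oU cL sf vs u Uu.
have oLU : open (L @^-1` U) by move/continuousP : cL; apply.
apply: (near_eq_differentiable (f := foldr (fun v (h : F -> G) => 'D_v h) f (map L vs) \o L)).
  near=> x; apply/esym; apply: (foldr_derive_comp oU cL sf).
  by near: x; apply: open_nbhs_nbhs.
apply: differentiable_comp; first exact: linear_differentiable.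
exact: sf.
Unshelve. all: by end_near.
Qed.

End SmoothCalculus.

(** * Smoothness at a point and matrix operations *)

Section SmoothAt.
Context {R : realType}.
Implicit Types E F : normedModType R.

Lemma smooth_at_near E F (u : E) (f g : E -> F) :
  (\near u, f u = g u) -> smooth_at u f -> smooth_at u g.
Proof.
move=> /nbhs_interior/nbhs_singleton fg [U [oU Uu sf]].
exists (U `&` interior [set x | f x = g x]); split.
- by apply: openI => //; exact: open_interior.
- by split => //; exact: fg.
- apply/smooth_onE => k.
  apply: (differentiable_upto_congr (f := f)).
  + by apply: openI => //; exact: open_interior.
  + by move=> x [_ /interior_subset].
  + move: k; apply/smooth_onE; apply: smooth_on_sub sf.
    exact: subIsetl.
Qed.

Lemma smooth_at_differentiable E F (u : E) (f : E -> F) :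
  smooth_at u f -> differentiable f u.
Proof. by case=> U [_ Uu /(_ [::] u Uu)]. Qed.

Lemma near_smooth_at E F (u : E) (f : E -> F) :
  smooth_at u f -> \near u, smooth_at u f.
Proof.
case=> U [oU Uu sf]; near=> x; exists U; split=> //.
by near: x; apply: open_nbhs_nbhs.
Unshelve. all: by end_near.
Qed.

Lemma smooth_at_derive E F (u v : E) (f : E -> F) :
  smooth_at u f -> smooth_at u ('D_v f).
Proof. by case=> U [oU Uu sf]; exists U; split=> //; exact: smooth_on_derive. Qed.

Lemma smooth_at_cst E F (u : E) (a : F) : smooth_at u (fun _ : E => a).
Proof.
exists setT; split; [exact: openT|by []|].
by apply/smooth_onE => k; exact: differentiable_upto_cst.
Qed.

(** Intersecting neighborhoods carries the binary closure properties from open sets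
    to points. *)
Lemma smooth_at2 E (F1 F2 F3 : normedModType R) (u : E) (f : E -> F1)
    (g : E -> F2) (h : E -> F3) :
  (forall k U, open U -> differentiable_upto k U f -> differentiable_upto k U g ->
     differentiable_upto k U h) ->
  smooth_at u f -> smooth_at u g -> smooth_at u h.
Proof.
move=> fgh [U [oU Uu sf]] [V [oV Vu sg]]; exists (U `&` V); split=> //.
  exact: openI.
apply/smooth_onE => k; apply: fgh; first exact: openI.
  by move: k; apply/smooth_onE; apply: smooth_on_sub sf; exact: subIsetl.
by move: k; apply/smooth_onE; apply: smooth_on_sub sg; exact: subIsetr.
Qed.

Lemma smooth_at_add E F (u : E) (f g : E -> F) :
  smooth_at u f -> smooth_at u g -> smooth_at u (fun x => f x + g x).
Proof. by apply: smooth_at2 => k U oU; exact: differentiable_upto_add. Qed.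

Lemma smooth_at_mul E (u : E) (f g : E -> R) :
  smooth_at u f -> smooth_at u g -> smooth_at u (fun x => f x * g x).
Proof. by apply: smooth_at2 => k U oU; exact: differentiable_upto_mul. Qed.

Lemma smooth_at_linear E F (G : normedModType R) (u : E) (L : {linear F -> G})
  (f : E -> F) : continuous L -> smooth_at u f -> smooth_at u (fun x => L (f x)).
Proof.
by move=> cL sf; apply: (smooth_at2 _ sf sf) => k U oU sg _; exact: differentiable_upto_linear.
Qed.

Lemma smooth_at_opp E F (u : E) (f : E -> F) :
  smooth_at u f -> smooth_at u (fun x => - f x).
Proof. by apply: (smooth_at_linear (L := -%R)) => x; exact: opp_continuous. Qed.

Lemma smooth_at_sub E F (u : E) (f g : E -> F) :
  smooth_at u f -> smooth_at u g -> smooth_at u (fun x => f x - g x).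
Proof. by move=> sf sg; apply: smooth_at_add => //; exact: smooth_at_opp. Qed.

Lemma smooth_at_sum E F (I : Type) (r : seq I) (P : pred I) (u : E)
    (f : I -> E -> F) : (forall i, P i -> smooth_at u (f i)) ->
  smooth_at u (fun x => \sum_(i <- r | P i) f i x).
Proof.
move=> sf; elim: r => [|i r IH].
  by apply: smooth_at_near (smooth_at_cst u 0); near=> x; rewrite big_nil.
case: (boolP (P i)) => Pi.
  apply: smooth_at_near (smooth_at_add (sf i Pi) IH).
  by near=> x; rewrite big_cons Pi.
apply: smooth_at_near IH.
by near=> x; rewrite big_cons (negbTE Pi).
Unshelve. all: by end_near.
Qed.

Lemma smooth_at_prod E (I : Type) (r : seq I) (P : pred I) (u : E)
    (f : I -> E -> R) : (forall i, P i -> smooth_at u (f i)) ->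
  smooth_at u (fun x => \prod_(i <- r | P i) f i x).
Proof.
move=> sf; elim: r => [|i r IH].
  by apply: smooth_at_near (smooth_at_cst u (1 : R)); near=> x; rewrite big_nil.
case: (boolP (P i)) => Pi.
  apply: smooth_at_near (smooth_at_mul (sf i Pi) IH).
  by near=> x; rewrite big_cons Pi.
apply: smooth_at_near IH.
by near=> x; rewrite big_cons (negbTE Pi).
Unshelve. all: by end_near.
Qed.

Lemma smooth_at_inv E (u : E) (f : E -> R) : f u != 0 ->
  smooth_at u f -> smooth_at u (fun x => (f x)^-1).
Proof.
move=> f0 [U [oU Uu sf]].
have /differentiable_continuous cf := sf [::] u Uu.
have nf0 : \near u, f u != 0.
  have := open_nbhs_nbhs (conj (@open_neq R 0) f0).
  by move=> /cf.
exists (U `&` interior [set x | f x != 0]).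
have oW : open (U `&` interior [set x | f x != 0]).
  by apply: openI => //; exact: open_interior.
split; [by []|by split; [by []|exact: nf0]|].
apply/smooth_onE => k; apply: differentiable_upto_inv => //.
  by move=> x [_ /interior_subset].
by move: k; apply/smooth_onE; apply: smooth_on_sub sf; exact: subIsetl.
Qed.

Lemma smooth_at_comp_linear E F (G : normedModType R) (L : {linear E -> F})
    (u : E) (f : F -> G) : continuous L -> smooth_at (L u) f ->
  smooth_at u (fun x => f (L x)).
Proof.
move=> cL [U [oU Uu sf]]; exists (L @^-1` U); split => //.
  by move/continuousP : cL; apply.
exact: smooth_on_comp_linear.
Qed.

Definition mx_coord m n (i : 'I_m) (j : 'I_n) (A : 'M[R]_(m, n)) : R := A i j.

Fact mx_coord_linear m n (i : 'I_m) (j : 'I_n) : linear (mx_coord i j : _ -> R^o).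
Proof. by move=> a A B; rewrite /mx_coord !mxE. Qed.
HB.instance Definition _ m n (i : 'I_m) (j : 'I_n) :=
  GRing.isLinear.Build R 'M[R]_(m, n) R _ (@mx_coord m n i j) (@mx_coord_linear m n i j).

Lemma smooth_at_coord E m n (u : E) (M : E -> 'M[R]_(m, n)) i j :
  smooth_at u M -> smooth_at u (fun x => M x i j).
Proof.
apply: (smooth_at_linear (L := mx_coord i j)).
exact: coord_continuous.
Qed.

(** Scaling a fixed vector is linear in the scalar. *)
Lemma smooth_at_scale_cst E F (u : E) (f : E -> R) (a : F) :
  smooth_at u f -> smooth_at u (fun x => f x *: a).
Proof.
pose L := ( *:%R ^~ a : R -> F).
have Llin : linear (L : R^o -> F) by move=> k x y; rewrite /L scalerDl scalerA.
pose LL := GRing.isLinear.Build _ _ _ _ L Llin.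
pose sL : {linear R -> F} := HB.pack L LL.
by apply: (smooth_at_linear (L := sL)); exact: scalel_continuous.
Qed.

(** Decomposing a matrix on the elementary ones reduces to real-valued maps. *)
Lemma smooth_at_mx E m n (u : E) (M : E -> 'M[R]_(m, n)) :
  (forall i j, smooth_at u (fun x => M x i j)) -> smooth_at u M.
Proof.
move=> sM.
apply: (smooth_at_near (f := fun x => \sum_i \sum_j M x i j *: delta_mx i j)).
  by near=> x; rewrite -matrix_sum_delta.
apply: smooth_at_sum => i _; apply: smooth_at_sum => j _.
exact: smooth_at_scale_cst.
Unshelve. all: by end_near.
Qed.

Lemma smooth_at_ext E F (u : E) (f g : E -> F) :
  f =1 g -> smooth_at u f -> smooth_at u g.
Proof. by move=> /funext ->. Qed.

Lemma smooth_at_mulmx E m n p (u : E) (A : E -> 'M[R]_(m, n))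
    (B : E -> 'M[R]_(n, p)) :
  smooth_at u A -> smooth_at u B -> smooth_at u (fun x => A x *m B x).
Proof.
move=> sA sB; apply: smooth_at_mx => i j.
apply: smooth_at_ext (fun x => esym (mxE _ _ _ _)) _.
by apply: smooth_at_sum => k _; apply: smooth_at_mul; exact: smooth_at_coord.
Qed.

Lemma smooth_at_trmx E m n (u : E) (A : E -> 'M[R]_(m, n)) :
  smooth_at u A -> smooth_at u (fun x => (A x)^T).
Proof.
move=> sA; apply: smooth_at_mx => i j.
apply: smooth_at_ext (fun x => esym (mxE _ _ _ _)) _.
exact: smooth_at_coord.
Qed.

Lemma smooth_at_scale E m n (u : E) (f : E -> R) (A : E -> 'M[R]_(m, n)) :
  smooth_at u f -> smooth_at u A -> smooth_at u (fun x => f x *: A x).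
Proof.
move=> sf sA; apply: smooth_at_mx => i j.
apply: smooth_at_ext (fun x => esym (mxE _ _ _ _)) _.
by apply: smooth_at_mul => //; exact: smooth_at_coord.
Qed.

Lemma smooth_at_det E n (u : E) (A : E -> 'M[R]_n) :
  smooth_at u A -> smooth_at u (fun x => \det (A x)).
Proof.
move=> sA; rewrite /determinant; apply: smooth_at_sum => s _.
apply: smooth_at_mul; first exact: smooth_at_cst.
by apply: smooth_at_prod => i _; exact: smooth_at_coord.
Qed.

Lemma smooth_at_adj E n (u : E) (A : E -> 'M[R]_n) :
  smooth_at u A -> smooth_at u (fun x => \adj (A x)).
Proof.
move=> sA; apply: smooth_at_mx => i j.
apply: smooth_at_ext (fun x => esym (mxE _ _ _ _)) _.
apply: smooth_at_mul; first exact: smooth_at_cst.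
apply: smooth_at_det; apply: smooth_at_mx => k l.
apply: (@smooth_at_ext _ _ _ (fun x => A x (lift j k) (lift i l))).
  by move=> x; rewrite !mxE.
exact: smooth_at_coord.
Qed.

(** Near a point where the determinant does not vanish the inverse is the adjugate
    divided by the determinant. *)
Lemma smooth_at_invmx E n (u : E) (A : E -> 'M[R]_n) : A u \in unitmx ->
  smooth_at u A -> smooth_at u (fun x => invmx (A x)).
Proof.
move=> Au sA; have sd := smooth_at_det sA.
have d0 : \det (A u) != 0 by rewrite -unitfE -unitmxE.
apply: (smooth_at_near (f := fun x => (\det (A x))^-1 *: \adj (A x))); last first.
  by apply: smooth_at_scale; [exact: smooth_at_inv|exact: smooth_at_adj].
near=> x.
rewrite /invmx ifT // unitmxE unitfE; near: x.
have /smooth_at_differentiable/differentiable_continuous cf := sd.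
by have := open_nbhs_nbhs (conj (@open_neq R 0) d0) => /cf.
Unshelve. all: by end_near.
Qed.

Lemma smooth_at_bil E n (u : E) (G : E -> 'M[R]_n) (a b : E -> 'rV[R]_n) :
  smooth_at u G -> smooth_at u a -> smooth_at u b ->
  smooth_at u (fun x => bil (G x) (a x) (b x)).
Proof.
move=> sG sa sb; apply: smooth_at_coord; apply: smooth_at_mulmx.
  exact: smooth_at_mulmx.
exact: smooth_at_trmx.
Qed.

(** Stated with a basis and its dual basis so that it passes to products, which
    jet spaces are. *)
Definition finite_coordinates F : Prop :=
  exists (I : finType) (e : I -> F) (phi : I -> {linear F -> R}),
    (forall k, continuous (phi k)) /\ forall v, v = \sum_k phi k v *: e k.

Lemma matrix_finite_coordinates m n :
  finite_coordinates ('M[R]_(m, n) : normedModType R).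
Proof.
exists ('I_m * 'I_n)%type, (fun k => delta_mx k.1 k.2).
exists (fun k => mx_coord k.1 k.2 : {linear _ -> R}); split.
  by move=> k; exact: coord_continuous.
move=> v; rewrite -(pair_big xpredT xpredT (fun i j => mx_coord i j v *: delta_mx i j)) /=.
exact: matrix_sum_delta.
Qed.

Lemma prod_finite_coordinates F (G : normedModType R) :
  finite_coordinates F -> finite_coordinates G ->
  finite_coordinates ((F * G)%type : normedModType R).
Proof.
move=> [I [e [phi [cphi phiE]]]] [I' [e' [phi' [cphi' phiE']]]].
exists (I + I')%type.
exists (fun k => match k with inl i => (e i, 0) | inr i => (0, e' i) end).
exists (fun k => match k return {linear (F * G)%type -> R} with
                 | inl i => phi i \o fst | inr i => phi' i \o snd end).
split.
  case=> i x; apply: continuous_comp; try exact: cvg_fst; try exact: cvg_snd.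
    exact: cphi.
  exact: cphi'.
move=> [v w]; rewrite big_sumType /=.
rewrite {1}(phiE v) {1}(phiE' w).
apply/pair_equal_spec; split.
  rewrite !raddf_sum /= [X in _ + X]big1 ?addr0 // => i _.
  by rewrite scaler0.
rewrite !raddf_sum /= [X in X + _]big1 ?add0r // => i _.
by rewrite scaler0.
Qed.

(** A linear map is the finite sum of the images of the basis scaled by the
    coordinates. *)
Lemma finite_coordinates_continuous F (G : normedModType R)
    (L : {linear F -> G}) : finite_coordinates F -> continuous L.
Proof.
move=> [I [e [phi [cphi phiE]]]].
have -> : (L : F -> G) = (fun v => \sum_k phi k v *: L (e k)).
  by apply/funext => v; rewrite {1}(phiE v) linear_sum; under eq_bigr do rewrite linearZ.
elim: (index_enum I) => [|k r IH].
  by under eq_fun do rewrite big_nil; exact: cst_continuous.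
under eq_fun do rewrite big_cons.
move=> v; apply: cvgD; last exact: IH.
by apply: cvgZr_tmp; exact: cphi.
Qed.

(** In coordinates, the derivative along a variable vector is a finite sum of
    products of coordinates with partial derivatives. *)
Lemma smooth_at_derive_along E F (u : E) (L : {linear E -> F}) (w : E -> F)
    (T : F -> R) : continuous L -> finite_coordinates F ->
  smooth_at (L u) T -> smooth_at u w ->
  smooth_at u (fun x => 'D_(w x) T (L x)).
Proof.
move=> cL [I [e [phi [cphi phiE]]]] sT sw.
apply: (smooth_at_near (f := fun x => \sum_k phi k (w x) * 'D_(e k) T (L x))).
  have := near_smooth_at sT.
  move/(cL u) => nT.
  near=> x.
  have dT : differentiable T (L x).
    by apply: smooth_at_differentiable; near: x.
  rewrite deriveE // [in RHS](phiE (w x)) linear_sum.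
  by apply: eq_bigr => k _; rewrite linearZ deriveE.
apply: smooth_at_sum => k _; apply: smooth_at_mul.
  exact: smooth_at_linear.
apply: (smooth_at_comp_linear (f := 'D_(e k) T)) => //; exact: smooth_at_derive.
Unshelve. all: by end_near.
Qed.

Lemma derive_coord F m n (T : F -> 'M[R]_(m, n)) u v i j :
  differentiable T u -> 'D_v T u i j = 'D_v (fun x => T x i j) u.
Proof. by move=> dT; rewrite derive_mx ?mxE //; exact: diff_derivable. Qed.

Lemma smooth_at_derive_along_mx E F (u : E) (L : {linear E -> F}) (w : E -> F)
    m n (T : F -> 'M[R]_(m, n)) : continuous L -> finite_coordinates F ->
  smooth_at (L u) T -> smooth_at u w ->
  smooth_at u (fun x => 'D_(w x) T (L x)).
Proof.
move=> cL fF sT sw; apply: smooth_at_mx => i j.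
apply: (smooth_at_near (f := fun x => 'D_(w x) (fun y => T y i j) (L x))).
  have := near_smooth_at sT.
  move/(cL u) => nT.
  near=> x.
  rewrite derive_coord //; apply: smooth_at_differentiable; near: x.
  exact: nT.
by apply: smooth_at_derive_along => //; exact: smooth_at_coord.
Unshelve. all: by end_near.
Qed.

End SmoothAt.

(** * Linear algebra of a degenerate hyperplane *)

Section Bilinear.
Context {R : realType}.

Lemma bilDl n (G : 'M[R]_n) a b c : bil G (a + b) c = bil G a c + bil G b c.
Proof. by rewrite /bil !mulmxDl !mxE. Qed.

Lemma bilDr n (G : 'M[R]_n) a b c : bil G a (b + c) = bil G a b + bil G a c.
Proof. by rewrite /bil raddfD mulmxDr !mxE. Qed.

Lemma bilZl n (G : 'M[R]_n) k a b : bil G (k *: a) b = k * bil G a b.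
Proof. by rewrite /bil -!scalemxAl !mxE. Qed.

Lemma bilZr n (G : 'M[R]_n) k a b : bil G a (k *: b) = k * bil G a b.
Proof. by rewrite /bil linearZ -scalemxAr !mxE. Qed.

Lemma bilC n (G : 'M[R]_n) a b : G^T = G -> bil G a b = bil G b a.
Proof.
move=> Gs; rewrite /bil -[LHS]/((fun M : 'M[R]_1 => M 0 0) _).
rewrite -[a *m G *m b^T]trmxK [LHS]mxE; congr (fun M : 'M[R]_1 => M 0 0).
by rewrite !trmx_mul trmxK Gs mulmxA.
Qed.

Lemma bil_mulmx n p (A : 'M[R]_(p, n)) (G : 'M[R]_n) x y :
  bil G (x *m A) (y *m A) = bil (A *m G *m A^T) x y.
Proof. by rewrite /bil trmx_mul !mulmxA. Qed.

Lemma mulmx_tr_eq0 n (x : 'rV[R]_n) : x *m x^T = 0 -> x = 0.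
Proof.
move=> /matrixP/(_ 0 0); rewrite !mxE => /eqP.
under eq_bigr do rewrite mxE -expr2.
rewrite psumr_eq0; last by move=> i _; exact: sqr_ge0.
move=> /allP x0; apply/rowP => i; rewrite mxE.
by apply/eqP; rewrite -sqrf_eq0; apply: x0; rewrite mem_index_enum.
Qed.

Lemma row_free_inj n p (M : 'M[R]_(n, p)) :
  (forall x : 'rV_n, x *m M = 0 -> x = 0) -> row_free M.
Proof.
move=> M0; rewrite -kermx_eq0; apply/eqP/row_matrixP => i.
by rewrite row0; apply: M0; rewrite -row_mul mulmx_ker row0.
Qed.

Lemma row_free_mul0 n p (M : 'M[R]_(n, p)) (x : 'rV_n) :
  row_free M -> x *m M = 0 -> x = 0.
Proof. by move=> Mf /eqP; rewrite mulmx_free_eq0 // => /eqP. Qed.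

Lemma unitmx_gram n p (A : 'M[R]_(p, n)) : row_free A -> A *m A^T \in unitmx.
Proof.
move=> Af; rewrite -row_free_unit; apply: row_free_inj => x xA.
apply: (row_free_mul0 Af); apply: mulmx_tr_eq0.
by rewrite trmx_mul -mulmxA [A *m _]mulmxA [x *m _]mulmxA xA mul0mx.
Qed.

Lemma kernel_line n p (M : 'M[R]_(n.+1, p)) (l x : 'rV_n.+1) :
  \rank M = n -> l != 0 -> l *m M = 0 -> x *m M = 0 -> exists k, x = k *: l.
Proof.
move=> rM l0 /sub_kermxP lM /sub_kermxP xM.
have /mxrank_leqif_eq := lM; rewrite mxrank_ker rM subSn // subnn.
rewrite rank_rV l0 => -[_ /esym]; rewrite eqxx => /andP[_ kl].
by have /sub_rVP[k ->] := submx_trans xM kl; exists k.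
Qed.

End Bilinear.

Section LightlikeAlgebra.
Context {R : realType} {m : nat}.
Implicit Types (A : 'M[R]_(m.+1, m.+2)) (G : 'M[R]_m.+2) (j : 'cV[R]_m.+1).

(** The induced metric, in coordinates of the hypersurface. *)
Definition null_form A G : 'M[R]_m.+1 := A *m G *m A^T.

(** The vector of the kernel of the induced metric on which [j] takes the value 1:
    if [l] is in that kernel and [l j = 1] then [l (H + j j^T) = j^T]. *)
Definition null_row A G j : 'rV[R]_m.+1 :=
  j^T *m invmx (null_form A G + j *m j^T).

Definition null_vec A G j : 'rV[R]_m.+2 := null_row A G j *m A.

(** A vector [b] of the ambient space with [G(b, w A) = w j] for every tangent [w]. *)
Definition conormal_lift A G j : 'rV[R]_m.+2 :=
  j^T *m invmx (A *m A^T) *m A *m invmx G.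

(** Adding a multiple of the null vector does not change the scalar products with
    the screen; this multiple makes the vector isotropic. *)
Definition normal_vec A G j : 'rV[R]_m.+2 :=
  let b := conormal_lift A G j in b - (2^-1 * bil G b b) *: null_vec A G j.

(** The scalar product with the null vector measures the component along the normal
    vector; the remaining tangent vector is read off by the right inverse
    [A^T (A A^T)^-1] of [A]. *)
Definition tangent_part A G j (v : 'rV[R]_m.+2) : 'rV[R]_m.+1 :=
  (v - bil G v (null_vec A G j) *: normal_vec A G j)
  *m A^T *m invmx (A *m A^T).

Definition transversal_data A G j : Prop :=
  [/\ G^T = G, G \in unitmx, \rank A = m.+1, \rank (null_form A G) = m &
      forall l : 'rV_m.+1, l != 0 -> l *m null_form A G = 0 -> l *m j != 0].

Lemma null_form_sym A G : G^T = G -> (null_form A G)^T = null_form A G.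
Proof. by move=> Gs; rewrite /null_form !trmx_mul trmxK Gs mulmxA. Qed.

Lemma exists_null_row A G : \rank (null_form A G) = m ->
  exists2 l : 'rV_m.+1, l != 0 & l *m null_form A G = 0.
Proof.
move=> rH; have : kermx (null_form A G) != 0.
  by rewrite kermx_eq0 /row_free rH neq_ltn ltnSn.
move=> /rowV0Pn[l lH l0]; exists l => //; exact/sub_kermxP.
Qed.

Section Data.
Variables (A : 'M[R]_(m.+1, m.+2)) (G : 'M[R]_m.+2) (j : 'cV[R]_m.+1).
Hypothesis dat : transversal_data A G j.
Let H := null_form A G.
Let l := null_row A G j.
Let L := null_vec A G j.
Let b := conormal_lift A G j.
Let a := normal_vec A G j.

Let Gs : G^T = G. Proof. by case: dat. Qed.
Let Gu : G \in unitmx. Proof. by case: dat. Qed.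
Let Af : row_free A. Proof. by case: dat => _ _ rA _ _; apply/eqP. Qed.

Lemma exists_normalized_null_row : exists l0 : 'rV_m.+1,
  [/\ l0 != 0, l0 *m H = 0 & l0 *m j = 1%:M].
Proof.
have [_ _ _ rH tr] := dat.
have [w w0 wH] := exists_null_row rH; have wj := tr w w0 wH.
have wj0 : (w *m j) 0 0 != 0.
  by apply: contra wj => /eqP wj; apply/eqP; rewrite [LHS]mx11_scalar wj raddf0.
exists (((w *m j) 0 0)^-1 *: w); split.
- by rewrite scaler_eq0 invr_eq0 (negbTE wj0).
- by rewrite -scalemxAl wH scaler0.
- by rewrite -scalemxAl {2}[w *m j]mx11_scalar scale_scalar_mx mulVf.
Qed.

(** Pairing [x (H + j j^T) = 0] with the null vector gives [x j = 0], so [x] lies in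
    the kernel of [H], where [j] vanishes only at 0. *)
Lemma bordered_unit : H + j *m j^T \in unitmx.
Proof.
have [_ _ _ rH tr] := dat; have [l0 [l00 l0H l0j]] := exists_normalized_null_row.
rewrite -row_free_unit; apply: row_free_inj => x xM.
have xj : x *m j = 0.
  have := congr1 (fun M => M *m l0^T) xM; rewrite mul0mx mulmxDr mulmxDl.
  rewrite -[x *m H *m _]mulmxA -[H](null_form_sym A Gs) -trmx_mul.
  by rewrite l0H trmx0 mulmx0 add0r -!mulmxA -trmx_mul l0j trmx1 !mulmx1.
have xH : x *m H = 0 by move: xM; rewrite mulmxDr mulmxA xj mul0mx addr0.
have [//|xn0] := eqVneq x 0.
by have := tr x xn0 xH; rewrite xj eqxx.
Qed.

Lemma null_row_spec : l *m H = 0 /\ l *m j = 1%:M.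
Proof.
have [l0 [_ l0H l0j]] := exists_normalized_null_row.
suff -> : l = l0 by [].
have -> : l0 = l0 *m (H + j *m j^T) *m invmx (H + j *m j^T).
  by rewrite mulmxK // bordered_unit.
by rewrite mulmxDr l0H add0r mulmxA l0j mul1mx.
Qed.

Lemma null_row_neq0 : l != 0.
Proof.
apply/eqP => l0; have [_] := null_row_spec; rewrite l0 mul0mx => /matrixP/(_ 0 0).
by rewrite !mxE /= => /eqP; rewrite eq_sym oner_eq0.
Qed.

Lemma bil_tangent_null (w : 'rV_m.+1) : bil G (w *m A) L = 0.
Proof.
rewrite /L /null_vec bil_mulmx bilC ?null_form_sym // /bil.
by have [-> _] := null_row_spec; rewrite mul0mx mxE.
Qed.

Lemma bil_conormal_tangent (w : 'rV_m.+1) : bil G b (w *m A) = (w *m j) 0 0.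
Proof.
rewrite /bil /b /conormal_lift mulmxKV // trmx_mul !mulmxA -[_ *m A *m _]mulmxA.
rewrite mulmxKV ?unitmx_gram //.
by rewrite -trmx_mul mxE.
Qed.

Lemma bil_conormal_null : bil G b L = 1.
Proof.
rewrite /L /null_vec bil_conormal_tangent.
by have [_ ->] := null_row_spec; rewrite mxE.
Qed.

Lemma bil_normal_null : bil G a L = 1.
Proof.
rewrite /a /normal_vec -scaleNr bilDl bilZl bil_conormal_null.
by rewrite [bil G L L]bil_tangent_null mulr0 addr0.
Qed.

Lemma bil_normal_normal : bil G a a = 0.
Proof.
rewrite /a /normal_vec -scaleNr !(bilDl, bilDr, bilZl, bilZr).
rewrite -/b -/L bil_conormal_null [bil G L L]bil_tangent_null.
by rewrite [bil G L b]bilC // bil_conormal_null; field.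
Qed.

Lemma normal_vec_neq0 : a != 0.
Proof.
apply/eqP => a0; have := bil_normal_null; rewrite a0 /bil mul0mx mul0mx mxE.
by move/eqP; rewrite eq_sym oner_eq0.
Qed.

(** The orthogonal of the tangent hyperplane is a line, and it contains the null
    vector. *)
Lemma orthogonal_tangent (v : 'rV_m.+2) :
  (forall w : 'rV_m.+1, bil G v (w *m A) = 0) -> exists k, v = k *: L.
Proof.
move=> vA; have [_ _ rA _ _] := dat.
have L0 : L != 0.
  by apply: contra null_row_neq0 => /eqP /(row_free_mul0 Af) l0; apply/eqP.
have rM : \rank (G *m A^T) = m.+1.
  by rewrite eqmxMfull ?mxrank_tr // row_full_unit.
have ker (x : 'rV_m.+2) :
    (forall w : 'rV_m.+1, bil G x (w *m A) = 0) -> x *m (G *m A^T) = 0.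
  move=> xA; apply/rowP => i; rewrite [RHS]mxE -(xA (delta_mx 0 i)).
  by rewrite /bil trmx_mul trmx_delta !mulmxA -colE [RHS]mxE.
apply: (kernel_line rM L0); apply: ker => // w.
by rewrite bilC // bil_tangent_null.
Qed.

(** A vector orthogonal to the screen is a combination [p b + t L] of the lift and
    of the null vector; being isotropic and not tangent determines [t] from [p]. *)
Lemma normal_vecP (v : 'rV_m.+2) :
  [/\ bil G v v = 0,
      (forall w : 'rV_m.+1, w *m j = 0 -> bil G v (w *m A) = 0) &
      ((v <= A)%MS -> v = 0)] <-> exists k, v = k *: a.
Proof.
split=> [[vv vS vA]|[k ->]].
  pose p := bil G v L.
  have [t vE] : exists t, v - p *: b = t *: L.
    apply: orthogonal_tangent => w.
    rewrite -scaleNr bilDl bilZl bil_conormal_tangent.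
    (* The projection of [w] to the screen along the null vector. *)
    pose w' := w - (w *m j) 0 0 *: l.
    have w'j : w' *m j = 0.
      have [_ lj] := null_row_spec.
      by rewrite mulmxBl -scalemxAl lj scalemx1 -mx11_scalar subrr.
    have := vS _ w'j; rewrite /w' mulmxBl -scalemxAl -scaleNr bilDr bilZr.
    by rewrite -/(null_vec A G j) -/L -/p; lra.
  have vE' : v = p *: b + t *: L by rewrite -vE addrC subrK.
  have : p * (p * bil G b b + 2 * t) = 0.
    rewrite -[RHS]vv vE' !(bilDl, bilDr, bilZl, bilZr).
    rewrite bil_conormal_null [bil G L L]bil_tangent_null.
    by rewrite [bil G L b]bilC // bil_conormal_null; ring.
  have [p0|p0 /eqP] := eqVneq p 0.
    exists 0; rewrite scale0r; apply: vA; rewrite vE' p0 scale0r add0r.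
    by rewrite scalemx_sub // submxMl.
  rewrite mulf_eq0 (negbTE p0) /= => /eqP tE; exists p.
  rewrite vE' /a /normal_vec -/b -/L scalerBr scalerA -scaleNr.
  by congr (_ + _ *: _); lra.
split.
- by rewrite bilZl bilZr bil_normal_normal !mulr0.
- move=> w wj; rewrite bilZl /a /normal_vec -scaleNr bilDl bilZl.
  rewrite bil_conormal_tangent wj mxE add0r [bil G (null_vec _ _ _) _]bilC //.
  by rewrite -/L bil_tangent_null !mulr0.
- move=> /submxP[w kaE].
  have := bil_tangent_null w; rewrite -kaE bilZl bil_normal_null mulr1 => ->.
  by rewrite scale0r.
Qed.

(** The tangent hyperplane is the orthogonal of the null vector, so subtracting the
    normal component leaves a tangent vector. *)
Lemma tangent_partP (v : 'rV_m.+2) (t : 'rV_m.+1) :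
  (exists k, v - t *m A = k *: a) <-> t = tangent_part A G j v.
Proof.
have AAu := unitmx_gram Af.
split=> [[k vE]|->].
  have kE : bil G v L = k.
    rewrite -[v](subrK (t *m A)) vE bilDl bilZl bil_normal_null.
    by rewrite bil_tangent_null mulr1 addr0.
  rewrite /tangent_part -/L -/a kE -vE opprB addrC subrK.
  by rewrite -!mulmxA [A *m (_ *m _)]mulmxA mulmxV // mulmx1.
exists (bil G v L).
set v' := v - bil G v L *: a.
have v'L : bil G v' L = 0.
  by rewrite /v' -scaleNr bilDl bilZl bil_normal_null mulr1 subrr.
have [w wE] : exists w, v' = w *m A.
  apply/submxP; have [_ _ rA _ _] := dat.
  have L0 : L != 0.
    apply: contra null_row_neq0 => /eqP /(row_free_mul0 Af) l0.
    exact/eqP.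
  have kerL (x : 'rV_m.+2) : bil G x L = 0 -> x *m (G *m L^T) = 0.
    by move=> xL; rewrite mulmxA [LHS]mx11_scalar -[X in X%:M]/(bil G x L) xL raddf0.
  have AL : (A <= kermx (G *m L^T))%MS.
    apply/sub_kermxP/row_matrixP => i; rewrite row0 row_mul.
    by apply: kerL; rewrite rowE bil_tangent_null.
  have /mxrank_leqif_eq := AL; rewrite mxrank_ker rA.
  rewrite eqmxMfull ?row_full_unit // mxrank_tr rank_rV L0 subn1 => -[_ /esym].
  rewrite eqxx => /andP[_]; apply: submx_trans.
  by apply/sub_kermxP; exact: kerL.
have -> : tangent_part A G j v = w.
  rewrite /tangent_part -/L -/a -/v' wE.
  by rewrite -!mulmxA [A *m (_ *m _)]mulmxA mulmxV // mulmx1.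
by rewrite -wE /v' subKr.
Qed.

End Data.

(** * Positivity of the screen and adapted bases *)

Lemma bil_lorentz (a b : 'rV[R]_m.+2) : bil lorentz_diag a b =
  \sum_(i < m.+1) a 0 (lift ord_max i) * b 0 (lift ord_max i)
  - a 0 ord_max * b 0 ord_max.
Proof.
rewrite /bil mul_mx_diag mxE (bigD1 ord_max) //= addrC.
congr (_ + _); last by rewrite !mxE eqxx mulrN1 mulNr.
rewrite (reindex_omap (lift ord_max) (unlift ord_max)) /=; last first.
  by move=> i; case: unliftP => [k ->|->]; rewrite ?eqxx.
apply: eq_big => [i|i _]; first by rewrite liftK eqxx eq_sym neq_lift.
by rewrite !mxE eq_sym (negbTE (neq_lift _ _)) mulr1.
Qed.

(** A null vector has a nonzero time component, so a multiple of it can be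
    subtracted from [s] to make [s] purely spatial without changing its square. *)
Lemma lorentz_diag_pos (L s : 'rV[R]_m.+2) : L != 0 ->
  bil lorentz_diag L L = 0 -> bil lorentz_diag s L = 0 ->
  (forall k, s != k *: L) -> 0 < bil lorentz_diag s s.
Proof.
move=> L0 LL sL sk.
have Ds : (lorentz_diag : 'M[R]_m.+2)^T = lorentz_diag by rewrite tr_diag_mx.
have Ln : L 0 ord_max != 0.
  apply: contra L0 => /eqP Ln; move: LL; rewrite bil_lorentz Ln mulr0 subr0 => /eqP.
  rewrite psumr_eq0; last by move=> i _; rewrite -expr2 sqr_ge0.
  move=> /allP L0; apply/eqP/rowP => i; rewrite mxE.
  case: (unliftP ord_max i) => [k ->|->] //.
  by apply/eqP; rewrite -sqrf_eq0 expr2; apply: L0; rewrite mem_index_enum.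
pose k := s 0 ord_max / L 0 ord_max.
(* [k] is chosen so that the time component of [s'] is zero. *)
pose s' := s - k *: L.
have -> : bil lorentz_diag s s = bil lorentz_diag s' s'.
  rewrite /s' -scaleNr !(bilDl, bilDr, bilZl, bilZr) LL sL.
  by rewrite [bil _ L s]bilC // sL; ring.
have s'n : s' 0 ord_max = 0 by rewrite !mxE divfK // subrr.
have s'0 : s' != 0 by rewrite subr_eq0 sk.
rewrite bil_lorentz s'n mulr0 subr0 lt_neqAle; apply/andP; split; last first.
  by apply: sumr_ge0 => i _; rewrite -expr2 sqr_ge0.
rewrite eq_sym; apply: contra s'0.
rewrite psumr_eq0; last by move=> i _; rewrite -expr2 sqr_ge0.
move=> /allP s0; apply/eqP/rowP => i; rewrite [RHS]mxE.
case: (unliftP ord_max i) => [p ->|->] //.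
by apply/eqP; rewrite -sqrf_eq0 expr2; apply: s0; rewrite mem_index_enum.
Qed.

(** By Sylvester's congruence the claim is one about the diagonal form. *)
Lemma orthogonal_null_pos G (P : 'M[R]_m.+2) (L s : 'rV[R]_m.+2) :
  P \in unitmx -> P *m G *m P^T = lorentz_diag -> L != 0 ->
  bil G L L = 0 -> bil G s L = 0 -> (forall k, s != k *: L) -> 0 < bil G s s.
Proof.
move=> Pu PG L0 LL sL sk.
have bilP x y : bil G x y = bil lorentz_diag (x *m invmx P) (y *m invmx P).
  by rewrite -PG -bil_mulmx !mulmxKV.
rewrite bilP; apply: (@lorentz_diag_pos (L *m invmx P)); rewrite -?bilP //.
  by apply: contra L0 => /eqP LP; rewrite -[L](mulmxKV Pu) LP mul0mx.
move=> k; apply: contra (sk k) => /eqP sP.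
by rewrite -[s](mulmxKV Pu) sP -scalemxAl mulmxKV.
Qed.

Lemma kernel_basis (j : 'cV[R]_m.+1) : j != 0 ->
  exists B : 'M[R]_(m, m.+1), \rank B = m /\ B *m j = 0.
Proof.
move=> j0.
have rj : \rank j = 1%N.
  by rewrite -mxrank_tr rank_rV; apply/eqP; rewrite eqb1 -(inj_eq trmx_inj) trmxK trmx0.
have rk : \rank (kermx j) = m by rewrite mxrank_ker rj subn1.
exists (castmx (rk, erefl) (row_base (kermx j))); split.
  by rewrite (eqmx_cast (row_base (kermx j)) (rk, erefl)) eq_row_base.
apply/sub_kermxP; by rewrite (eqmx_cast (row_base (kermx j)) (rk, erefl)) eq_row_base.
Qed.

Lemma lorentz_gram_unit G (P : 'M[R]_m.+2) :
  P *m G *m P^T = lorentz_diag -> G \in unitmx.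
Proof.
move=> PG; have : (lorentz_diag : 'M[R]_m.+2) \in unitmx.
  rewrite unitmxE det_diag unitfE; apply/prodf_neq0 => i _.
  by rewrite mxE; case: ifP => _; rewrite ?oppr_eq0 oner_neq0.
by rewrite -PG !unitmx_mul => /andP[/andP[]].
Qed.

(** The screen is taken to be the kernel of the transpose of a null vector [w] of
    the induced metric, which is transversal because [w w^T <> 0]; the last vector
    is the opposite of the isotropic normal of that screen. *)
Lemma exists_adapted_basis A G (P : 'M[R]_m.+2) : G^T = G ->
  P \in unitmx -> P *m G *m P^T = lorentz_diag -> \rank A = m.+1 ->
  \rank (null_form A G) = m ->
  exists E : 'M[R]_m.+2, let H := E *m G *m E^T in
  [/\ E \in unitmx, (row' ord_max E == A)%MS,
   [/\ H ord0 ord0 = 0, H ord_max ord_max = 0 & H ord0 ord_max = -1],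
   (forall a, a != ord0 -> a != ord_max -> H ord0 a = 0 /\ H a ord_max = 0) &
   (forall v : 'rV_m.+2, v 0 ord0 = 0 -> v 0 ord_max = 0 -> v != 0 ->
      0 < bil H v v)].
Proof.
move=> Gs Pu PG rA rH.
have Gu := lorentz_gram_unit PG.
(* The standard scalar product makes a null vector into a covector that does
   not vanish on it. *)
have [w w0 wH] := exists_null_row rH.
have ww : (w *m w^T) != 0.
  by apply: contra w0 => /eqP /mulmx_tr_eq0 ->.
have dat : transversal_data A G w^T.
  split=> // l l0 lH; have [k lE] := kernel_line rH w0 wH lH.
  rewrite lE -scalemxAl scaler_eq0 negb_or ww andbT.
  by apply: contra l0 => /eqP k0; rewrite lE k0 scale0r.
have j0 : w^T != 0 by rewrite -(inj_eq trmx_inj) trmxK trmx0.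
have [B [rB Bj]] := kernel_basis j0.
pose l := null_row A G w^T; pose L := null_vec A G w^T.
pose a := normal_vec A G w^T.
have [lH lj] := null_row_spec dat; rewrite -/l in lH lj.
have tL x : bil G (x *m A) L = 0 := bil_tangent_null dat x.
have aL : bil G a L = 1 := bil_normal_null dat.
have aa : bil G a a = 0 := bil_normal_normal dat.
have aB (x : 'rV_m) : bil G (x *m B *m A) a = 0.
  rewrite bilC //; have [_ /(_ (ex_intro _ 1 (esym (scale1r _))))] := normal_vecP dat a.
  by case=> _ aS _; apply: aS; rewrite -mulmxA Bj mulmx0.
have Bf : row_free B by apply/eqP.
have Af : row_free A by apply/eqP.
pose C : 'M[R]_m.+1 := \matrix_i oapp (fun k => row k B) l (unlift ord0 i).
have rowC0 : row ord0 C = l by rewrite rowK unlift_none.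
have rowCS k : row (lift ord0 k) C = row k B by rewrite rowK liftK.
have mulC (x : 'rV_m.+1) :
    x *m C = x 0 ord0 *: l + (\row_k x 0 (lift ord0 k)) *m B.
  rewrite mulmx_sum_row (bigD1_ord ord0) //= rowC0; congr (_ + _).
  by rewrite mulmx_sum_row; apply: eq_bigr => k _; rewrite rowCS mxE.
have mulC_eq0 (x : 'rV_m) k : x *m B = k *: l -> x = 0 /\ k = 0.
  move=> xB; have k0 : k = 0.
    have := congr1 (fun M => (M *m w^T) 0 0) xB.
    by rewrite -mulmxA Bj mulmx0 -scalemxAl lj scalemx1 !mxE eqxx mulr1n => <-.
  by split=> //; apply: (row_free_mul0 Bf); rewrite xB k0 scale0r.
have Cf : row_free C.
  apply: row_free_inj => x; rewrite mulC addrC => /eqP.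
  rewrite addr_eq0 -scaleNr => /eqP /mulC_eq0[x'0 /eqP]; rewrite oppr_eq0 => /eqP x0.
  apply/rowP => i; rewrite [RHS]mxE; case: (unliftP ord0 i) => [k ->|-> //].
  by move/rowP: x'0 => /(_ k); rewrite !mxE.
pose E : 'M[R]_m.+2 :=
  \matrix_i oapp (fun k => row k C *m A) (- a) (unlift ord_max i).
have rowEn : row ord_max E = - a by rewrite rowK unlift_none.
have rowEt k : row (lift ord_max k) E = row k C *m A by rewrite rowK liftK.
have ord0E : ord0 = lift ord_max ord0 :> 'I_m.+2 by apply: val_inj.
have rowE0 : row ord0 E = L by rewrite ord0E rowEt rowC0.
have mulE (x : 'rV_m.+2) :
    x *m E = - x 0 ord_max *: a + (\row_k x 0 (lift ord_max k)) *m C *m A.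
  rewrite mulmx_sum_row (bigD1_ord ord_max) //= rowEn scalerN scaleNr.
  congr (_ + _); rewrite -mulmxA mulmx_sum_row; apply: eq_bigr => k _.
  by rewrite rowEt mxE row_mul.
have HE i k : (E *m G *m E^T) i k = bil G (row i E) (row k E).
  by rewrite !rowE bil_mulmx /bil trmx_delta -rowE -colE [RHS]mxE [RHS]mxE.
exists E => /=; split.
- rewrite -row_free_unit; apply: row_free_inj => x; rewrite mulE => xE.
  have xn : x 0 ord_max = 0.
    have := congr1 (fun y => bil G y L) xE.
    rewrite bilDl bilZl tL aL mulr1 addr0 /bil !mul0mx mxE => /eqP.
    by rewrite oppr_eq0 => /eqP.
  move: xE; rewrite xn oppr0 scale0r add0r => /(row_free_mul0 Af).
  move=> /(row_free_mul0 Cf) x0; apply/rowP => i; rewrite [RHS]mxE.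
  case: (unliftP ord_max i) => [k ->|-> //].
  by move/rowP: x0 => /(_ k); rewrite !mxE.
- have -> : row' ord_max E = C *m A.
    by apply/row_matrixP => i; rewrite row_mul -rowEt; apply/rowP => k; rewrite !mxE.
  by apply/eqmxP; apply: eqmxMfull; rewrite row_full_unit -row_free_unit.
- split; rewrite HE ?rowE0 ?rowEn; first exact: tL.
    by rewrite -scaleN1r bilZl bilZr aa !mulr0.
  by rewrite -scaleN1r bilZr bilC // aL mulr1.
- move=> i i0 imax; rewrite !HE rowE0 rowEn.
  case: (unliftP ord_max i) imax => [k iE|-> /eqP //] _.
  case: (unliftP ord0 k) => [q kE|kE]; last by case/eqP: i0; rewrite iE kE ord0E.
  rewrite iE rowEt kE rowCS rowE; split; first by rewrite bilC // tL.
  by rewrite -scaleN1r bilZr aB mulr0.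
- move=> v v0 vn vneq0; rewrite -bil_mulmx mulE vn oppr0 scale0r add0r mulC.
  rewrite mxE -ord0E v0 scale0r add0r; set x := (\row_k _ : 'rV_m).
  apply: (@orthogonal_null_pos G P L) => //.
  + apply: contra (null_row_neq0 dat) => /eqP /(row_free_mul0 Af) l0.
    exact/eqP.
  + exact: tL.
  move=> k; apply: contra vneq0 => /eqP; rewrite /L /null_vec scalemxAl => /eqP.
  rewrite -subr_eq0 -mulmxBl => /eqP /(row_free_mul0 Af) /eqP.
  rewrite subr_eq0 => /eqP /mulC_eq0[x0 _].
  apply/eqP/rowP => i; rewrite [RHS]mxE.
  case: (unliftP ord_max i) => [q ->|-> //].
  case: (unliftP ord0 q) => [q' ->|->]; last by rewrite -ord0E.
  by move/rowP: x0 => /(_ q'); rewrite !mxE.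
Qed.

End LightlikeAlgebra.

(** * Jacobians and charts *)

Local Opaque jacobian jac derive.

Section Jacobian.
Context {R : realType}.

Lemma row_jacobian n p (f : 'rV[R]_n -> 'rV[R]_p) u i :
  differentiable f u -> row i ('J f u) = 'D_(delta_mx 0 i) f u.
Proof. by move=> df; rewrite rowE (deriveEjacobian _ df). Qed.

Lemma jacobian_near n p (f h : 'rV[R]_n -> 'rV[R]_p) u :
  (\near u, f u = h u) -> differentiable f u -> 'J f u = 'J h u.
Proof.
move=> fh df; have dh := near_eq_differentiable fh df.
apply/row_matrixP => i; rewrite [LHS](row_jacobian _ df) [RHS](row_jacobian _ dh).
exact: near_eq_derive.
Qed.

Lemma jacobian_comp n p q (f : 'rV[R]_n -> 'rV[R]_p) (h : 'rV[R]_p -> 'rV[R]_q) u :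
  differentiable f u -> differentiable h (f u) ->
  'J (h \o f) u = 'J f u *m 'J h (f u).
Proof.
move=> df dh; have dhf := differentiable_comp df dh.
apply/row_matrixP => i; rewrite [LHS](row_jacobian _ dhf) [RHS]row_mul.
rewrite [X in _ = X *m _](row_jacobian _ df).
rewrite -[RHS](deriveEjacobian _ dh) [LHS](deriveE _ dhf) [RHS](deriveE _ dh).
by rewrite (diff_comp df dh) (deriveE _ df).
Qed.

Lemma jacobian_id n (u : 'rV[R]_n) : 'J id u = 1%:M.
Proof.
apply/row_matrixP => i.
by rewrite (row_jacobian _ (@ex_diff _ _ _ _ _ _ _ (is_diff_id u))) derive_id row1.
Qed.

End Jacobian.

Section ChartCalculus.
Context {R : realType}.

Lemma codP (M : topologicalType) n (c : @chart R M n) u : is_chart c ->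
  cod c u -> dom c (bwd c u) /\ fwd c (bwd c u) = u.
Proof. by move=> [_ _ _ _ cK] [x xc <-]; rewrite cK. Qed.

(** A chart domain is reached by all parameters close to the given one, by
    continuity of the inverse chart and of the map. *)
Lemma near_bwd (M M' : topologicalType) n (c : @chart R M n) (f : M -> M')
    (D : set M') x : is_chart c -> continuous f -> open D -> dom c x ->
  D (f x) -> \forall u \near fwd c x, cod c u /\ D (f (bwd c u)).
Proof.
move=> ic cf oD xc Dx; have [_ oc _ cb cK] := ic.
have cx : cod c (fwd c x) by exists x.
have Dn : nbhs (f (bwd c (fwd c x))) D by rewrite cK //; exact: open_nbhs_nbhs.
near=> u; split; near: u; first exact: open_nbhs_nbhs.
exact: (cb _ cx) _ (cf _ _ Dn).
Unshelve. all: by end_near.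
Qed.

Lemma open_overlap (M M' : topologicalType) n n' (c : @chart R M n)
    (d : @chart R M' n') (f : M -> M') :
  is_chart c -> is_chart d -> continuous f -> open (overlap c d f).
Proof.
move=> ic [od _ _ _ _] cf; rewrite openE => _ [x [xc xd] <-].
rewrite /interior; near=> u.
have [uc ud] : cod c u /\ dom d (f (bwd c u)).
  by near: u; exact: (near_bwd ic cf od).
by have [bc fb] := codP ic uc; exists (bwd c u).
Unshelve. all: by end_near.
Qed.

Lemma smooth_at_loc n n' (M : manifold R n) (M' : manifold R n') (f : M -> M')
    c d x : smooth_map f -> atlas c -> atlas d -> dom c x -> dom d (f x) ->
  smooth_at (fwd c x) (loc c d f).
Proof.
move=> [cf sf] ac ad xc xd; exists (overlap c d f); split; last exact: sf.
  by apply: open_overlap => //; exact: atlas_chart.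
by exists x.
Qed.

Lemma smooth_map_id n (M : manifold R n) : smooth_map (id : M -> M).
Proof.
by split=> [x|c d ac ad]; [exact: cvg_id|exact: atlas_compatible].
Qed.

Lemma near_loc_bwd n n' (M : manifold R n) (M' : manifold R n') (f : M -> M')
    c d x : smooth_map f -> atlas c -> atlas d -> dom c x -> dom d (f x) ->
  \forall u \near fwd c x, bwd d (loc c d f u) = f (bwd c u).
Proof.
move=> [cf _] /atlas_chart ic /atlas_chart [od _ _ _ dK] xc xd.
have := near_bwd ic cf od xc xd; apply: filterS => u [_ fd].
exact: dK.
Qed.

Lemma jacE n n' (M : manifold R n) (M' : manifold R n') (f : M -> M')
    (c : @chart R M n) (d : @chart R M' n') x :
  jac c d f x = 'J (loc c d f) (fwd c x).
Proof. by []. Qed.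

(** Chain rule; the coordinate expressions compose only near the point, where the
    intermediate chart is defined. *)
Lemma jac_comp n n' n'' (M : manifold R n) (M' : manifold R n')
    (M'' : manifold R n'') (f : M -> M') (h : M' -> M'') c d e x :
  smooth_map f -> smooth_map h -> atlas c -> atlas d -> atlas e ->
  dom c x -> dom d (f x) -> dom e (h (f x)) ->
  jac c e (h \o f) x = jac c d f x *m jac d e h (f x).
Proof.
move=> sf sh ac ad ae xc xd xe.
have [_ _ _ _ cK] := atlas_chart ac.
have df := smooth_at_differentiable (smooth_at_loc sf ac ad xc xd).
have dh := smooth_at_differentiable (smooth_at_loc sh ad ae xd xe).
have fE : loc c d f (fwd c x) = fwd d (f x) by rewrite /loc cK.
have dh' : differentiable (loc d e h) (loc c d f (fwd c x)) by rewrite fE.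
have E := jacobian_comp df dh'; rewrite fE in E.
rewrite !jacE; apply: etrans E; apply/esym/jacobian_near; last exact: differentiable_comp.
have := near_loc_bwd sf ac ad xc xd; apply: filterS => u fb.
by rewrite /= /loc fb.
Qed.

Lemma jac_id n (M : manifold R n) (c : chart M n) x : atlas c -> dom c x ->
  jac c c id x = 1%:M.
Proof.
move=> ac xc; have sid := @smooth_map_id _ M.
rewrite jacE; apply: etrans (jacobian_id (fwd c x)); apply: jacobian_near; last first.
  exact: smooth_at_differentiable (smooth_at_loc sid ac ac xc xc).
have ic := atlas_chart ac; have [_ oc _ _ _] := ic.
have : \forall u \near fwd c x, cod c u.
  by apply: open_nbhs_nbhs; split=> //; exists x.
by apply: filterS => u /(codP ic)[].
Qed.

Lemma jac_diffeo_unit n (M M' : manifold R n) (f : M -> M') c d x :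
  diffeomorphism f -> atlas c -> atlas d -> dom c x -> dom d (f x) ->
  jac c d f x \in unitmx.
Proof.
move=> [sf [h [fK hK sh]]] ac ad xc xd.
have xh : dom c (h (f x)) by rewrite fK.
have E := jac_comp sf sh ac ad ac xc xd xh.
have hf : h \o f = id by apply/funext => y /=; rewrite fK.
rewrite hf in E.
have id1 := jac_id ac xc.
rewrite id1 in E.
have [fu hu] := mulmx1_unit (esym E).
exact: fu.
Qed.

(** Tangent vectors are rows, so a covector is a column acting by right
    multiplication. *)
Definition differential_col n (M : manifold R n) (f : M -> R) (c : chart M n) (x : M)
  : 'cV[R]_n := \col_i 'D_(delta_mx 0 i) (f \o bwd c) (fwd c x).

Lemma derive_differential_col n (M : manifold R n) (f : M -> R) c x w :
  differentiable (f \o bwd c) (fwd c x) ->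
  'D_w (f \o bwd c) (fwd c x) = (w *m differential_col f c x) 0 0.
Proof.
move=> df; rewrite deriveE // [in LHS](row_sum_delta w) linear_sum mxE.
by apply: eq_bigr => i _; rewrite linearZ mxE deriveE.
Qed.

Lemma smooth_function_at n (M : manifold R n) (f : M -> R) c x :
  smooth_function f -> atlas c -> dom c x -> smooth_at (fwd c x) (f \o bwd c).
Proof.
move=> sf ac xc; have [_ oc _ _ _] := atlas_chart ac.
by exists (cod c); split => //; [exists x|exact: sf].
Qed.

Lemma differential_col_comp n n' (M : manifold R n) (M' : manifold R n') (phi : M -> M')
    (f : M' -> R) c d x :
  smooth_map phi -> smooth_function f -> atlas c -> atlas d -> dom c x ->
  dom d (phi x) ->
  differential_col (f \o phi) c x = jac c d phi x *m differential_col f d (phi x).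
Proof.
move=> sp sf ac ad xc xd.
have [_ _ _ _ cK] := atlas_chart ac.
have dp := smooth_at_differentiable (smooth_at_loc sp ac ad xc xd).
have df := smooth_at_differentiable (smooth_function_at sf ad xd).
have fE : loc c d phi (fwd c x) = fwd d (phi x) by rewrite /loc cK.
have dc : differentiable ((f \o bwd d) \o loc c d phi) (fwd c x).
  by apply: differentiable_comp => //; rewrite fE.
apply/colP => i; rewrite mxE.
rewrite -(near_eq_derive (f := (f \o bwd d) \o loc c d phi)); last first.
  have := near_loc_bwd sp ac ad xc xd; apply: filterS => u fb.
  by rewrite /= fb.
rewrite deriveE // diff_comp ?fE //= -deriveE // -deriveE // derive_differential_col //.
rewrite deriveEjacobian // -jacE -mulmxA -rowE.
by rewrite mxE.
Qed.

End ChartCalculus.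

(** * Level distributions on a lightlike hypersurface *)

Section Hypersurface.
Context {R : realType} {m : nat} {M : manifold R m.+2} {g : lorentz_metric M}.
Variable V : lightlike g.
Implicit Types (c : mchart V) (d : mchart M) (x : V).

Let incl_smooth' : smooth_map (@incl _ _ _ _ V) := incl_smooth V.

Lemma jac_incl_left c c' d x : atlas c -> atlas c' -> atlas d ->
  dom c x -> dom c' x -> dom d (incl x) ->
  jac c' d (@incl _ _ _ _ V) x = jac c' c id x *m jac c d (@incl _ _ _ _ V) x.
Proof.
move=> ac ac' ad xc xc' xd.
exact: (jac_comp (smooth_map_id V) incl_smooth' ac' ac ad xc' xc xd).
Qed.

Lemma jac_incl_right c d d' x : atlas c -> atlas d -> atlas d' ->
  dom c x -> dom d (incl x) -> dom d' (incl x) ->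
  jac c d' (@incl _ _ _ _ V) x = jac c d (@incl _ _ _ _ V) x *m jac d d' id (incl x).
Proof.
move=> ac ad ad' xc xd xd'.
exact: (jac_comp incl_smooth' (smooth_map_id M) ac ad ad' xc xd xd').
Qed.

(** A change of ambient chart multiplies [A] by the Jacobian that the metric
    absorbs. *)
Lemma null_form_chart c d d' x : atlas c -> atlas d -> atlas d' ->
  dom c x -> dom d (incl x) -> dom d' (incl x) ->
  null_form (jac c d (@incl _ _ _ _ V) x) (gram g d (incl x)) =
  null_form (jac c d' (@incl _ _ _ _ V) x) (gram g d' (incl x)).
Proof.
move=> ac ad ad' xc xd xd'.
rewrite (jac_incl_right ac ad ad' xc xd xd') /null_form.
by rewrite (gram_change g ad ad' xd xd') trmx_mul !mulmxA.
Qed.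

(** Isotropy refers to every ambient chart, while the kernel of the induced metric
    is computed in one. *)
Lemma isotropic_null_row c d x (l : 'rV[R]_m.+1) : atlas c -> atlas d ->
  dom c x -> dom d (incl x) -> l != 0 ->
  l *m null_form (jac c d (@incl _ _ _ _ V) x) (gram g d (incl x)) = 0 ->
  isotropic c x l.
Proof.
move=> ac ad xc xd l0 lH; split=> // d' ad' xd'.
rewrite bil_mulmx -[X in bil X]/(null_form _ _).
by rewrite -(null_form_chart ac ad ad' xc xd xd') /bil lH mul0mx mxE.
Qed.

Lemma exists_isotropic c x : atlas c -> dom c x -> exists w, isotropic c x w.
Proof.
move=> ac xc; have [d ad xd] := atlas_cover (incl x).
have [l l0 lH] := exists_null_row (incl_lightlike ac ad xc xd).
by exists l; exact: isotropic_null_row lH.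
Qed.

(** The row space of the Jacobian does not depend on the chart of the hypersurface,
    so a basis adapted to one chart is a frame. *)
Lemma exists_frame x : exists fr : @frame R m M, first_order_frame (V := V) x fr.
Proof.
have [c ac xc] := atlas_cover x; have [d ad xd] := atlas_cover (incl x).
have [P Pu PG] := gram_signature g ad xd.
have [E [Eu EA H1 H2 H3]] := exists_adapted_basis (gram_sym g ad xd) Pu PG
  (incl_immersion ac ad xc xd) (incl_lightlike ac ad xc xd).
exists (d, E); split; first by split; [exact: ad|exact: xd|exact: Eu].
split; [|exact: H1|exact: H2|exact: H3] => c' ac' xc'.
have AA' : (jac c d (@incl _ _ _ _ V) x <= jac c' d (@incl _ _ _ _ V) x)%MS.
  by rewrite (jac_incl_left ac' ac ad xc' xc xd) submxMl.
have A'A : (jac c' d (@incl _ _ _ _ V) x <= jac c d (@incl _ _ _ _ V) x)%MS.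
  by rewrite (jac_incl_left ac ac' ad xc xc' xd) submxMl.
case/andP: EA => EA AE.
by rewrite (submx_trans EA AA') (submx_trans A'A AE).
Qed.

Lemma exists_frame_field : exists e : V -> @frame R m M, frame_field e.
Proof.
have [e eP] := choice exists_frame.
by exists e.
Qed.

Section Levels.
Variable f : V -> R.
Hypotheses (sf : smooth_function f) (rf : regular_levels f)
  (tf : transversal_levels f).

Lemma level_distribution_sub c x w : atlas c -> dom c x ->
  level_distribution f c x w -> w *m differential_col f c x = 0.
Proof.
move=> ac xc [gam [g0 ngam sgam gw]].
have [_ _ _ _ cK] := atlas_chart ac.
have df := smooth_at_differentiable (smooth_function_at sf ac xc).
have dg := smooth_at_differentiable sgam.
have df' : differentiable (f \o bwd c) ((fwd c \o gam) 0) by rewrite /= g0.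
have wE : w = 'd (fwd c \o gam) 0 1 by rewrite -gw derive1E'.
apply/matrixP => i j; rewrite !ord1 [RHS]mxE -derive_differential_col // wE deriveE //.
have -> : 'd (f \o bwd c) (fwd c x) ('d (fwd c \o gam) 0 1) =
          'd ((f \o bwd c) \o (fwd c \o gam)) 0 1.
  by rewrite [RHS](congr1 (fun F => F 1) (diff_comp dg df')) /= g0.
rewrite -deriveE; last exact: differentiable_comp.
rewrite (near_eq_derive (g := cst (f x))) ?derive_cst //.
by apply: filterS ngam => t [ct ft] /=; rewrite cK.
Qed.

Lemma differential_col_isotropic c x w : atlas c -> dom c x -> isotropic c x w ->
  w *m differential_col f c x != 0.
Proof.
move=> ac xc iw; apply/negP => /eqP wj.
have [v] := rf ac xc; case/negP; apply/eqP.
rewrite derive_differential_col; last first.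
  exact: smooth_at_differentiable (smooth_function_at sf ac xc).
have [s sl [k ->]] := tf ac xc iw v.
by rewrite mulmxDl (level_distribution_sub ac xc sl) -scalemxAl wj scaler0 addr0 mxE.
Qed.

(** A vector killed by the differential splits as a velocity plus [k] times an
    isotropic vector, and applying the differential gives [k = 0]. *)
Lemma level_distributionE c x : atlas c -> dom c x ->
  level_distribution f c x = [set w | w *m differential_col f c x = 0].
Proof.
move=> ac xc; apply/seteqP; split=> w; first exact: level_distribution_sub.
move=> wj; have [u iu] := exists_isotropic ac xc.
have [s sl [k wE]] := tf ac xc iu w.
suff k0 : k = 0 by rewrite wE k0 scale0r addr0.
have := wj; rewrite /= wE mulmxDl (level_distribution_sub ac xc sl) add0r -scalemxAl.
by move/eqP; rewrite scaler_eq0 (negbTE (differential_col_isotropic ac xc iu)) orbF => /eqP.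
Qed.

Lemma differential_col_neq0 c x : atlas c -> dom c x -> differential_col f c x != 0.
Proof.
move=> ac xc; have [w iw] := exists_isotropic ac xc.
by apply: contra (differential_col_isotropic ac xc iw) => /eqP ->; rewrite mulmx0.
Qed.

Lemma transversal_data_at c d x : atlas c -> atlas d ->
  dom c x -> dom d (incl x) ->
  transversal_data (jac c d (@incl _ _ _ _ V) x) (gram g d (incl x)) (differential_col f c x).
Proof.
move=> ac ad xc xd; split.
- exact: gram_sym.
- have [P Pu PG] := gram_signature g ad xd.
  exact: lorentz_gram_unit PG.
- exact: incl_immersion.
- exact: incl_lightlike.
- move=> l l0 lH; apply: differential_col_isotropic => //.
  exact: isotropic_null_row lH.
Qed.

(** Where the component [j_i0] of the differential does not vanish, its kernel has
    the basis [j_i0 e_k - j_k e_i0], for [k] distinct from [i0]. *)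
Lemma smooth_level_distribution : smooth_distribution (level_distribution f).
Proof.
move=> c x ac xc; have ic := atlas_chart ac.
have [_ oc _ _ _] := ic.
have cx : cod c (fwd c x) by exists x.
have sF := smooth_function_at sf ac xc.
pose J u : 'cV[R]_m.+1 := \col_i 'D_(delta_mx 0 i) (f \o bwd c) u.
have sJ : smooth_at (fwd c x) J.
  apply: smooth_at_mx => i j.
  apply: smooth_at_ext (smooth_at_derive (delta_mx 0 i) sF).
  by move=> u; rewrite mxE.
have [i0 ji0] : exists i, J (fwd c x) i 0 != 0.
  apply/existsP; rewrite -[X in is_true X]negbK negb_exists; apply/negP => /forallP j0.
  have := differential_col_neq0 ac xc; case/negP; apply/eqP/colP => i.
  by have := j0 i; rewrite negbK [RHS]mxE => /eqP.
pose B u : 'M[R]_(m, m.+1) := \matrix_(k, i)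
  ((J u i0 0) * (i == lift i0 k)%:R - (J u (lift i0 k) 0) * (i == i0)%:R).
have sJc i : smooth_at (fwd c x) (fun u => J u i 0) by exact: smooth_at_coord.
exists B; split.
  apply: smooth_at_mx => k i.
  apply: smooth_at_ext (fun u => esym (mxE _ _ _ _)) _.
  by apply: smooth_at_sub; apply: smooth_at_mul => //; exact: smooth_at_cst.
near=> u.
have uc : cod c u by near: u; exact: open_nbhs_nbhs.
have ji : J u i0 0 != 0.
  near: u.
  have /smooth_at_differentiable/differentiable_continuous cf := sJc i0.
  by have := open_nbhs_nbhs (conj (@open_neq R 0) ji0) => /cf.
have [bc fb] := codP ic uc.
have jE : differential_col f c (bwd c u) = J u by rewrite /differential_col fb.
have mulB (y : 'rV_m) i : (y *m B u) 0 i =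
   if unlift i0 i is Some k then y 0 k * J u i0 0
   else - (\sum_k y 0 k * J u (lift i0 k) 0).
  rewrite mxE; case: unliftP => [k ->|->].
    rewrite (bigD1 k) //= mxE eqxx eq_sym (negbTE (neq_lift _ _)) mulr1 mulr0 subr0.
    rewrite big1 ?addr0 // => q qk; rewrite mxE (inj_eq lift_inj) eq_sym (negbTE qk).
    by rewrite eq_sym (negbTE (neq_lift _ _)) !mulr0 subr0 mulr0.
  rewrite -sumrN; apply: eq_bigr => k _.
  by rewrite mxE eqxx (negbTE (neq_lift _ _)) mulr0 mulr1 add0r mulrN.
have Bf : row_free (B u).
  apply: row_free_inj => y yB; apply/rowP => k.
  have : (y *m B u) 0 (lift i0 k) = 0 by rewrite yB mxE.
  rewrite mulB liftK => /eqP.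
  by rewrite mulf_eq0 (negbTE ji) orbF => /eqP ->; rewrite mxE.
have BJ : B u *m J u = 0.
  apply/matrixP => k q; rewrite ord1 mxE [RHS]mxE (bigD1 i0) //=.
  rewrite (bigD1 (lift i0 k)) /=; last first.
    by rewrite eq_sym neq_lift.
  rewrite big1 => [|i /andP[ii0 iik]].
    rewrite !mxE !eqxx (negbTE (neq_lift _ _)) eq_sym (negbTE (neq_lift _ _)).
    by rewrite !mulr0 !mulr1; ring.
  by rewrite mxE (negbTE ii0) (negbTE iik) !mulr0 subr0 mul0r.
have rB : \rank (B u) = m by apply/eqP.
split=> //; rewrite level_distributionE // jE; apply/seteqP; split=> w /=.
  move=> wJ.
  have BK : (B u <= kermx (J u))%MS by apply/sub_kermxP.
  have rJ : \rank (J u) = 1%N.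
    rewrite -mxrank_tr rank_rV; apply/eqP; rewrite eqb1.
    by apply: contra ji => /eqP/rowP/(_ i0); rewrite !mxE => ->.
  have /mxrank_leqif_eq := BK; rewrite mxrank_ker rB rJ subn1 => -[_ /esym].
  by rewrite eqxx => /andP[_]; apply: submx_trans; apply/sub_kermxP.
by move=> /submxP[y ->]; rewrite -mulmxA BJ mulmx0.
Unshelve. all: by end_near.
Qed.

Lemma screen_level_distribution : screen_distribution (level_distribution f).
Proof.
split; first exact: smooth_level_distribution.
move=> c x ac xc; have [B [_ nB]] := smooth_level_distribution ac xc.
have [rB SB] := nbhs_singleton nB.
have [_ _ _ _ cK] := atlas_chart ac.
rewrite cK // in SB.
exists (B (fwd c x)); split=> // w iw.
apply/negP => wB; have : level_distribution f c x w by rewrite SB.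
rewrite level_distributionE //= => /eqP; apply/negP.
exact: differential_col_isotropic.
Qed.

End Levels.
End Hypersurface.

Section IntrinsicLevels.
Context {R : realType} {m : nat}.
Context (M M' : manifold R m.+2) (g : lorentz_metric M) (g' : lorentz_metric M').
Context (V : lightlike g) (V' : lightlike g').

(** The two differentials correspond under the Jacobian of the diffeomorphism,
    which is invertible. *)
Lemma level_distribution_image (psi : V -> V') (f : V -> R) (f' : V' -> R) :
  smooth_function f -> regular_levels f -> transversal_levels f ->
  smooth_function f' -> regular_levels f' -> transversal_levels f' ->
  diffeomorphism psi -> f' \o psi = f ->
  forall c c' x, atlas c -> atlas c' -> dom c x -> dom c' (psi x) ->
  level_distribution f' c' (psi x) =
  (fun w => w *m jac c c' psi x) @` level_distribution f c x.
Proof.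
move=> sf rf tf sf' rf' tf' dpsi fE c c' x ac ac' xc xc'.
have ju := jac_diffeo_unit dpsi ac ac' xc xc'.
have [spsi _] := dpsi.
rewrite !level_distributionE // -fE (differential_col_comp spsi sf' ac ac' xc xc').
apply/seteqP; split=> [w wj|_ [w wj <-]] /=.
  exists (w *m invmx (jac c c' psi x)); rewrite /= ?mulmxA mulmxKV //.
by rewrite -mulmxA.
Qed.

End IntrinsicLevels.

(** * Jets and total derivatives *)

Section MoreSmooth.
Context {R : realType}.
Implicit Types E F : normedModType R.

Lemma smooth_at_id E (u : E) : smooth_at u (id : E -> E).
Proof.
exists setT; split; [exact: openT|by []|].
apply/smooth_onE => -[|k]; split=> //; try (by move=> x _; exact: ex_diff).
move=> v; rewrite (_ : 'D_v id = fun=> v); first exact: differentiable_upto_cst.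
by apply/funext => x; rewrite derive_id.
Qed.

Lemma smooth_at_linfun E F (L : {linear E -> F}) (u : E) :
  continuous L -> smooth_at u L.
Proof. by move=> cL; apply: (smooth_at_linear cL (smooth_at_id u)). Qed.

Lemma smooth_at_pair E F (G : normedModType R) (u : E) (f : E -> F) (h : E -> G) :
  smooth_at u f -> smooth_at u h ->
  smooth_at u (fun x => (f x, h x) : (F * G)%type).
Proof.
move=> sf sh.
pose L1 (v : F) : (F * G)%type := (v, 0); pose L2 (v : G) : (F * G)%type := (0, v).
have lin1 : linear L1.
  by move=> k x y; apply/pair_equal_spec; split; rewrite //= scaler0 addr0.
have lin2 : linear L2.
  by move=> k x y; apply/pair_equal_spec; split; rewrite //= scaler0 addr0.
pose B1 := GRing.isLinear.Build _ _ _ _ L1 lin1.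
pose B2 := GRing.isLinear.Build _ _ _ _ L2 lin2.
pose sL1 : {linear F -> (F * G)%type} := HB.pack L1 B1.
pose sL2 : {linear G -> (F * G)%type} := HB.pack L2 B2.
have c1 : continuous sL1 by move=> x; apply: cvg_pair; [exact: cvg_id|exact: cvg_cst].
have c2 : continuous sL2 by move=> x; apply: cvg_pair; [exact: cvg_cst|exact: cvg_id].
apply: smooth_at_ext (smooth_at_add (smooth_at_linear c1 sf) (smooth_at_linear c2 sh)).
by move=> x; apply/pair_equal_spec; rewrite /= addr0 add0r.
Qed.

Lemma derive_linear E F (G : normedModType R) (L : {linear F -> G}) (f : E -> F)
  u v : continuous L -> differentiable f u ->
  'D_v (fun x => L (f x)) u = L ('D_v f u).
Proof.
move=> cL df; have dL := linear_differentiable (f u) cL.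
rewrite (deriveE _ (differentiable_comp df dL)) (deriveE _ df).
by rewrite (diff_comp df dL) (diff_lin _ cL).
Qed.

Lemma derive_pair E F (G : normedModType R) (f : E -> F) (h : E -> G) u v :
  differentiable f u -> differentiable h u ->
  'D_v (fun x => (f x, h x)) u = ('D_v f u, 'D_v h u).
Proof.
move=> df dh; rewrite (deriveE _ (differentiable_pair df dh)).
by rewrite (diff_pair df dh) !deriveE.
Qed.

Lemma derive_comp E F (G : normedModType R) (f : E -> F) (h : F -> G) u v :
  differentiable f u -> differentiable h (f u) ->
  'D_v (fun x => h (f x)) u = 'D_('D_v f u) h (f u).
Proof.
move=> df dh; rewrite (deriveE _ (differentiable_comp df dh)).
by rewrite (diff_comp df dh) (deriveE _ df) (deriveE _ dh).
Qed.

Lemma derive_row n F (f : 'rV[R]_n -> F) u v : differentiable f u ->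
  'D_v f u = \sum_a v 0 a *: 'D_(delta_mx 0 a) f u.
Proof.
move=> df; rewrite (deriveE _ df) {1}(row_sum_delta v) linear_sum.
by apply: eq_bigr => a _; rewrite linearZ (deriveE _ df).
Qed.

End MoreSmooth.

Section Words.
Variable k : nat.

(** The word of length [q] that spells the iterated derivative along [s], padded by
    the empty derivative: a derivative of lower order appears in a jet under
    several words, and this is the one that is read. *)
Fixpoint word (q : nat) (s : seq 'I_k) : q.-tuple (option 'I_k) :=
  match q, s with
  | 0%N, _ => [tuple]
  | q'.+1, [::] => cons_tuple None (word q' [::])
  | q'.+1, a :: s' => cons_tuple (Some a) (word q' s')
  end.

Definition word_index q (t : q.-tuple (option 'I_k)) : 'I_#|jet_index k q| :=
  enum_rank t.

Context {R : realType} {F : normedModType R}.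
Implicit Type f : 'rV[R]_k -> F.

Definition derive_word (w : seq (option 'I_k)) f : 'rV[R]_k -> F :=
  foldr (fun o h => if o is Some a then 'D_(delta_mx 0 a) h else h) f w.

Lemma derive_wordE q (s : seq 'I_k) f : (size s <= q)%N ->
  derive_word (word q s) f = foldr (fun a h => 'D_(delta_mx 0 a) h) f s.
Proof.
elim: q s => [|q IH] [|a s] //=; first by move=> _; exact: (IH [::]).
by rewrite ltnS => sq; rewrite -(IH s sq).
Qed.

Lemma smooth_at_derive_word w f u : smooth_at u f -> smooth_at u (derive_word w f).
Proof. by move=> sf; elim: w => [|[a|] w IH] //=; exact: smooth_at_derive. Qed.

End Words.

Section Jets.
Context {R : realType} {k l : nat}.
Implicit Type f : 'rV[R]_k -> 'rV[R]_l.

Lemma jetE q f u (t : q.-tuple (option 'I_k)) j :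
  jet q f u (word_index t) j = derive_word t f u 0 j.
Proof. by rewrite mxE enum_rankK. Qed.

Lemma row_jet q f u (t : q.-tuple (option 'I_k)) :
  row (word_index t) (jet q f u) = derive_word t f u.
Proof. by apply/rowP => j; rewrite mxE jetE. Qed.

Lemma smooth_at_jet q f u : smooth_at u f -> smooth_at u (jet q f).
Proof.
move=> sf; apply: smooth_at_mx => i j.
apply: smooth_at_ext (fun x => esym (mxE _ _ _ _)) _.
by apply: smooth_at_coord; exact: smooth_at_derive_word.
Qed.

Lemma derive_jet q f u a : smooth_at u f ->
  'D_(delta_mx 0 a) (jet q f) u =
  \matrix_(i, j) jet q.+1 f u (word_index (cons_tuple (Some a) (enum_val i))) j.
Proof.
move=> sf; have dj := smooth_at_differentiable (smooth_at_jet q sf).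
apply/matrixP => i j; rewrite (derive_coord _ i j dj) [RHS]mxE jetE /=.
rewrite derive_coord; last first.
  by apply: smooth_at_differentiable; exact: smooth_at_derive_word.
by congr ('D_ _ _ _); apply/funext => x; rewrite mxE.
Qed.

Lemma pad_jet q f u :
  jet q f u = \matrix_(i, j) jet q.+1 f u (word_index (cons_tuple None (enum_val i))) j.
Proof. by apply/matrixP => i j; rewrite !mxE enum_rankK. Qed.

End Jets.

Section JetSpace.
Context {R : realType} {m : nat}.
Local Notation JS q := (@jet_space R m q).

Lemma jet_space_coordinates q : finite_coordinates (JS q).
Proof. by apply: prod_finite_coordinates; exact: matrix_finite_coordinates. Qed.

(** A word prefixed by the empty derivative spells the same derivative. *)
Definition jet_truncate q (j : JS q.+2) : JS q.+1 :=
  (\matrix_(s, b) j.1 (word_index (cons_tuple None (enum_val s))) b,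
   \matrix_(s, b) j.2 (word_index (cons_tuple None (enum_val s))) b).

Fact jet_truncate_linear q : linear (@jet_truncate q).
Proof.
by move=> a x y; apply/pair_equal_spec; split; apply/matrixP => s b; rewrite !mxE.
Qed.
HB.instance Definition _ q := GRing.isLinear.Build R (JS q.+2) (JS q.+1) _
  (@jet_truncate q) (@jet_truncate_linear q).

Lemma jet_truncate_continuous q : continuous (@jet_truncate q).
Proof. exact: finite_coordinates_continuous (jet_space_coordinates _). Qed.

(** The partial derivative of the embedding along [s], when [s] has length at most
    [q]. *)
Definition jet_embedding q (j : JS q) (s : seq 'I_m.+1) : 'rV[R]_m.+2 :=
  row (word_index (word q s)) j.1.

Definition jet_gram q (j : JS q) (s : seq 'I_m.+2) : 'M[R]_m.+2 :=
  vec_mx (row (word_index (word q.-1 s)) j.2).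

(** The derivative, along the [i]-th coordinate line of the hypersurface, of the
    jet at a moving point.  The jet of the metric moves along the embedding,
    whence the combination of its partial derivatives. *)
Definition jet_shift (i : 'I_m.+1) q (j : JS q.+2) : JS q.+1 :=
  (\matrix_(s, b) j.1 (word_index (cons_tuple (Some i) (enum_val s))) b,
   \sum_a jet_embedding j [:: i] 0 a *:
     \matrix_(s, b) j.2 (word_index (cons_tuple (Some a) (enum_val s))) b).

Lemma smooth_at_jet1 q (j0 : JS q) a b : smooth_at j0 (fun j => j.1 a b).
Proof.
apply: smooth_at_coord; apply: (smooth_at_linfun (L := fst)) => x; exact: cvg_fst.
Qed.

Lemma smooth_at_jet2 q (j0 : JS q) a b : smooth_at j0 (fun j => j.2 a b).
Proof.
apply: smooth_at_coord; apply: (smooth_at_linfun (L := snd)) => x; exact: cvg_snd.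
Qed.

Lemma smooth_at_jet_embedding q (j0 : JS q) s : smooth_at j0 (fun j => jet_embedding j s).
Proof.
apply: smooth_at_mx => i b; apply: smooth_at_ext (smooth_at_jet1 _ (word_index (word q s)) b).
by move=> j; rewrite mxE.
Qed.

Lemma smooth_at_jet_gram q (j0 : JS q) s : smooth_at j0 (fun j => jet_gram j s).
Proof.
apply: smooth_at_mx => i b.
apply: smooth_at_ext (smooth_at_jet2 _ (word_index (word q.-1 s)) (mxvec_index i b)).
by move=> j; rewrite !mxE.
Qed.

Lemma smooth_at_jet_shift i q (j0 : JS q.+2) : smooth_at j0 (@jet_shift i q).
Proof.
apply: smooth_at_pair.
  apply: smooth_at_mx => s b; apply: smooth_at_ext (fun x => esym (mxE _ _ _ _)) _.
  exact: smooth_at_jet1.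
apply: smooth_at_sum => a _; apply: smooth_at_scale.
  by apply: smooth_at_coord; exact: smooth_at_jet_embedding.
apply: smooth_at_mx => s b; apply: smooth_at_ext (fun x => esym (mxE _ _ _ _)) _.
exact: smooth_at_jet2.
Qed.

(** The derivative of [T] of the jet at a moving point; it is a function of the
    jet of the next order. *)
Definition total_derive (W : normedModType R) q (i : 'I_m.+1) (T : JS q.+1 -> W)
  (j : JS q.+2) : W := 'D_(jet_shift i j) T (jet_truncate j).

Lemma smooth_at_total_derive q i (T : JS q.+1 -> R) j :
  smooth_at (jet_truncate j) T -> smooth_at j (total_derive i T).
Proof.
move=> sT; apply: (smooth_at_derive_along (L := @jet_truncate q)) => //.
- exact: jet_truncate_continuous.
- exact: jet_space_coordinates.
- exact: smooth_at_jet_shift.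
Qed.

Lemma smooth_at_total_derive_mx q i a b (T : JS q.+1 -> 'M[R]_(a, b)) j :
  smooth_at (jet_truncate j) T -> smooth_at j (total_derive i T).
Proof.
move=> sT; apply: (smooth_at_derive_along_mx (L := @jet_truncate q)) => //.
- exact: jet_truncate_continuous.
- exact: jet_space_coordinates.
- exact: smooth_at_jet_shift.
Qed.

Section AlongHypersurface.
Context {M : manifold R m.+2} {g : lorentz_metric M} (V : lightlike g).
Variables (c : mchart V) (d : mchart M).
Hypotheses (ac : atlas c) (ad : atlas d).
Local Notation iota := (@incl _ _ _ _ V).
Local Notation phi := (loc c d iota).
Local Notation gramd := (fun y => mxvec (gram g d (bwd d y))).

Lemma smooth_at_embedding x : dom c x -> dom d (incl x) -> smooth_at (fwd c x) phi.
Proof. by move=> xc xd; apply: smooth_at_loc => //; exact: incl_smooth. Qed.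

Lemma smooth_at_gram y : dom d y -> smooth_at (fwd d y) (gram g d \o bwd d).
Proof.
move=> yd; have [_ od _ _ _] := atlas_chart ad.
by exists (cod d); split => //; [exists y|exact: gram_smooth].
Qed.

Lemma mxvec_continuous p q : continuous (mxvec : 'M[R]_(p, q) -> 'rV[R]_(p * q)).
Proof.
exact: (finite_coordinates_continuous (L := mxvec)) (matrix_finite_coordinates _ _).
Qed.

Lemma smooth_at_gramd y : dom d y -> smooth_at (fwd d y) gramd.
Proof.
by move=> yd; apply: smooth_at_linear (smooth_at_gram yd); exact: mxvec_continuous.
Qed.

Lemma jet_truncate_jets q x : jet_truncate (jets c d q.+2 x) = jets c d q.+1 x.
Proof. by rewrite /jet_truncate /jets /= -!pad_jet. Qed.

Lemma phiE x : dom c x -> phi (fwd c x) = fwd d (incl x).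
Proof. by move=> xc; rewrite /loc; have [_ _ _ _ ->] := atlas_chart ac. Qed.

(** Differentiating an entry of a jet prefixes its word by one letter. *)
Lemma derive_jets q x i (jm := fun u => (jet q.+1 phi u, jet q gramd (phi u)) : JS q.+1) :
  dom c x -> dom d (incl x) ->
  differentiable jm (fwd c x) /\
  'D_(delta_mx 0 i) jm (fwd c x) = jet_shift i (jets c d q.+2 x).
Proof.
move=> xc xd; have sp := smooth_at_embedding xc xd; have sg := smooth_at_gramd xd.
have d1 := smooth_at_differentiable (smooth_at_jet q.+1 sp).
have dp := smooth_at_differentiable sp.
have d2 : differentiable (jet q gramd) (phi (fwd c x)).
  by rewrite phiE //; apply: smooth_at_differentiable; exact: smooth_at_jet.
split; first exact: differentiable_pair d1 (differentiable_comp dp d2).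
rewrite (derive_pair _ d1 (differentiable_comp dp d2)); apply/pair_equal_spec; split.
  exact: derive_jet.
rewrite (derive_comp _ dp d2) phiE // derive_row; last by rewrite -phiE.
apply: eq_bigr => a _; rewrite derive_jet //; congr (_ *: _).
congr (fun v : 'rV_m.+2 => v 0 a).
by rewrite /jet_embedding /jets /= row_jet (derive_wordE (s := [:: i])).
Qed.

Lemma near_domain x : dom c x -> dom d (incl x) ->
  \forall u \near fwd c x, [/\ dom c (bwd c u), fwd c (bwd c u) = u
      & dom d (incl (bwd c u))].
Proof.
move=> xc xd; have [ci _] := incl_smooth V; have [od _ _ _ _] := atlas_chart ad.
have ic := atlas_chart ac.
have := near_bwd ic ci od xc xd; apply: filterS => u [uc ud].
by have [bc fb] := codP ic uc.
Qed.

(** Chain rule for a function of the jet at a moving point. *)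
Lemma total_deriveP (W : normedModType R) q i (T : JS q.+1 -> W) x :
  dom c x -> dom d (incl x) -> smooth_at (jets c d q.+1 x) T ->
  'D_(delta_mx 0 i) (fun u => T (jets c d q.+1 (bwd c u))) (fwd c x) =
  total_derive i T (jets c d q.+2 x).
Proof.
move=> xc xd sT; have [dj Dj] := derive_jets q i xc xd.
set jm := (fun u => _) in dj Dj.
have jmx : jm (fwd c x) = jets c d q.+1 x by rewrite /jm phiE.
rewrite (near_eq_derive (g := fun u => T (jm u))); last first.
  have := near_domain xc xd; apply: filterS => u [_ fb _].
  by rewrite /jets /jm fb.
rewrite (derive_comp _ dj); last by rewrite jmx; exact: smooth_at_differentiable.
by rewrite jmx Dj /total_derive jet_truncate_jets.
Qed.

End AlongHypersurface.
End JetSpace.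

(** * Normalization and curvature as functions of jets *)

Section SmoothNormal.
Context {R : realType} {m : nat} {E : normedModType R}.
Variables (A : E -> 'M[R]_(m.+1, m.+2)) (G : E -> 'M[R]_m.+2)
  (j : E -> 'cV[R]_m.+1) (u : E).
Hypotheses (sA : smooth_at u A) (sG : smooth_at u G) (sj : smooth_at u j).
Hypothesis dat : transversal_data (A u) (G u) (j u).

Let sAT : smooth_at u (fun x => (A x)^T). Proof. exact: smooth_at_trmx. Qed.
Let sjT : smooth_at u (fun x => (j x)^T). Proof. exact: smooth_at_trmx. Qed.
Let sGi : smooth_at u (fun x => invmx (G x)).
Proof. by apply: smooth_at_invmx sG; case: dat. Qed.
Let sAAi : smooth_at u (fun x => invmx (A x *m (A x)^T)).
Proof.
apply: smooth_at_invmx; last exact: smooth_at_mulmx.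
by apply: unitmx_gram; case: dat => _ _ rA _ _; apply/eqP.
Qed.

Lemma smooth_at_null_vec : smooth_at u (fun x => null_vec (A x) (G x) (j x)).
Proof.
apply: smooth_at_mulmx sA; apply: smooth_at_mulmx sjT _.
apply: smooth_at_invmx; first exact: bordered_unit.
apply: smooth_at_add; last exact: smooth_at_mulmx.
by apply: smooth_at_mulmx sAT; exact: smooth_at_mulmx.
Qed.

Lemma smooth_at_normal_vec : smooth_at u (fun x => normal_vec (A x) (G x) (j x)).
Proof.
have sb : smooth_at u (fun x => conormal_lift (A x) (G x) (j x)).
  apply: smooth_at_mulmx sGi; apply: smooth_at_mulmx sA.
  exact: smooth_at_mulmx.
apply: (smooth_at_sub sb); apply: smooth_at_scale smooth_at_null_vec.
by apply: smooth_at_mul; [exact: smooth_at_cst|exact: (smooth_at_bil sG sb sb)].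
Qed.

Lemma smooth_at_tangent_part (v : E -> 'rV[R]_m.+2) : smooth_at u v ->
  smooth_at u (fun x => tangent_part (A x) (G x) (j x) (v x)).
Proof.
move=> sv; apply: smooth_at_mulmx sAAi; apply: smooth_at_mulmx sAT.
apply: (smooth_at_sub sv); apply: smooth_at_scale smooth_at_normal_vec.
exact: (smooth_at_bil sG sv smooth_at_null_vec).
Qed.

End SmoothNormal.

Section JetRules.
Context {R : realType} {m : nat}.
Local Notation JS q := (@jet_space R m q).

Definition jet_tangent q (j : JS q) : 'M[R]_(m.+1, m.+2) :=
  \matrix_(i < m.+1) jet_embedding j [:: i].

Definition jet_metric q (j : JS q) : 'M[R]_m.+2 := jet_gram j [::].

Definition jet_gram_derive q (j : JS q) (v : 'rV[R]_m.+2) : 'M[R]_m.+2 :=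
  \sum_a v 0 a *: jet_gram j [:: a].

Definition jet_christoffel q (j : JS q) (a b : 'rV[R]_m.+2) : 'rV[R]_m.+2 :=
  (\row_k (2^-1 * (bil (jet_gram_derive j a) b (delta_mx 0 k)
                   + bil (jet_gram_derive j b) a (delta_mx 0 k)
                   - bil (jet_gram_derive j (delta_mx 0 k)) a b)))
  *m invmx (jet_metric j).

Lemma smooth_at_jet_tangent q (j0 : JS q) : smooth_at j0 (@jet_tangent q).
Proof.
apply: smooth_at_mx => i b.
apply: smooth_at_ext (smooth_at_coord 0 b (smooth_at_jet_embedding j0 [:: i])) => j.
by rewrite !mxE.
Qed.

Lemma smooth_at_jet_metric q (j0 : JS q) : smooth_at j0 (@jet_metric q).
Proof. exact: smooth_at_jet_gram. Qed.

Lemma smooth_at_jet_gram_derive q (j0 : JS q) (v : JS q -> 'rV[R]_m.+2) :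
  smooth_at j0 v -> smooth_at j0 (fun j => jet_gram_derive j (v j)).
Proof.
move=> sv; apply: smooth_at_sum => a _; apply: smooth_at_scale.
  exact: smooth_at_coord.
exact: smooth_at_jet_gram.
Qed.

Lemma smooth_at_jet_christoffel q (j0 : JS q) (a b : JS q -> 'rV[R]_m.+2) :
  jet_metric j0 \in unitmx -> smooth_at j0 a -> smooth_at j0 b ->
  smooth_at j0 (fun j => jet_christoffel j (a j) (b j)).
Proof.
move=> Gu sa sb; apply: smooth_at_mulmx; last first.
  by apply: smooth_at_invmx => //; exact: smooth_at_jet_metric.
apply: smooth_at_mx => i k; apply: smooth_at_ext (fun x => esym (mxE _ _ _ _)) _.
have se : smooth_at j0 (fun _ : JS q => delta_mx 0 k : 'rV[R]_m.+2).
  exact: smooth_at_cst.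
apply: smooth_at_mul; first exact: smooth_at_cst.
apply: smooth_at_sub; last by apply: smooth_at_bil => //; exact: smooth_at_jet_gram_derive.
by apply: smooth_at_add; apply: smooth_at_bil => //; exact: smooth_at_jet_gram_derive.
Qed.

Section Rules.
Variable q : nat.
Variable F : JS q.+1 -> R.

Definition jet_differential (j : JS q.+2) : 'cV[R]_m.+1 := \col_i total_derive i F j.

Definition jet_normal (j : JS q.+2) : 'rV[R]_m.+2 :=
  normal_vec (jet_tangent j) (jet_metric j) (jet_differential j).

Definition jet_tangent_part (j : JS q.+2) (v : 'rV[R]_m.+2) : 'rV[R]_m.+1 :=
  tangent_part (jet_tangent j) (jet_metric j) (jet_differential j) v.

(** The components of the induced connection: the derivative of the [k]-th
    coordinate field along the [i]-th one, projected to the hypersurface. *)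
Definition jet_connection (i k : 'I_m.+1) (j : JS q.+2) : 'rV[R]_m.+1 :=
  jet_tangent_part j (jet_embedding j [:: i; k]
    + jet_christoffel j (row i (jet_tangent j)) (row k (jet_tangent j))).

(** Covariant derivative along the [i]-th coordinate field of the field with
    components [jet_connection j k]; differentiating these components is a total
    derivative, which costs one order. *)
Definition jet_second_derivative (i j k : 'I_m.+1) (J : JS q.+3) : 'rV[R]_m.+1 :=
  jet_tangent_part (jet_truncate J)
    (total_derive i (fun J' => jet_connection j k J' *m jet_tangent J') J
     + jet_christoffel (jet_truncate J) (row i (jet_tangent (jet_truncate J)))
         (jet_connection j k (jet_truncate J) *m jet_tangent (jet_truncate J))).

(** Coordinate fields commute, so the third term of the curvature vanishes. *)
Definition jet_curvature (i j k : 'I_m.+1) (J : JS q.+3) : 'rV[R]_m.+1 :=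
  jet_second_derivative i j k J - jet_second_derivative j i k J.

(** At these jets every matrix inverted in the formulas is invertible, so the formulas
    are smooth there. *)
Definition jet_regular (j : JS q.+2) : Prop :=
  smooth_at (jet_truncate j) F /\
  transversal_data (jet_tangent j) (jet_metric j) (jet_differential j).

Section At.
Variable j0 : JS q.+2.
Hypothesis reg : jet_regular j0.

Lemma smooth_at_jet_differential : smooth_at j0 jet_differential.
Proof.
apply: smooth_at_mx => i b; apply: smooth_at_ext (fun x => esym (mxE _ _ _ _)) _.
by apply: smooth_at_total_derive; case: reg.
Qed.

Lemma smooth_at_jet_normal : smooth_at j0 jet_normal.
Proof.
apply: smooth_at_normal_vec; last by case: reg.
- exact: smooth_at_jet_tangent.
- exact: smooth_at_jet_metric.
- exact: smooth_at_jet_differential.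
Qed.

Lemma smooth_at_jet_tangent_part v : smooth_at j0 v ->
  smooth_at j0 (fun j => jet_tangent_part j (v j)).
Proof.
move=> sv; apply: smooth_at_tangent_part => //; last by case: reg.
- exact: smooth_at_jet_tangent.
- exact: smooth_at_jet_metric.
- exact: smooth_at_jet_differential.
Qed.

Lemma jet_metric_unit : jet_metric j0 \in unitmx.
Proof. by case: reg => _ []. Qed.

Lemma smooth_at_row_jet_tangent i : smooth_at j0 (fun j => row i (jet_tangent j)).
Proof.
apply: smooth_at_ext (smooth_at_jet_embedding j0 [:: i]) => j.
by apply/rowP => b; rewrite !mxE.
Qed.

Lemma smooth_at_jet_connection i k : smooth_at j0 (jet_connection i k).
Proof.
apply: smooth_at_jet_tangent_part; apply: smooth_at_add; first exact: smooth_at_jet_embedding.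
apply: smooth_at_jet_christoffel; first exact: jet_metric_unit.
- exact: smooth_at_row_jet_tangent.
- exact: smooth_at_row_jet_tangent.
Qed.

End At.

Lemma smooth_at_jet_curvature (J0 : JS q.+3) i j k :
  jet_regular (jet_truncate J0) -> smooth_at J0 (jet_curvature i j k).
Proof.
move=> reg.
have pull (W : normedModType R) (T : JS q.+2 -> W) :
    smooth_at (jet_truncate J0) T -> smooth_at J0 (fun J => T (jet_truncate J)).
  apply: (smooth_at_comp_linear (L := @jet_truncate _ _ q.+1)).
  exact: jet_truncate_continuous.
have sc i' j' : smooth_at J0 (jet_second_derivative i' j' k).
  have sY : smooth_at (jet_truncate J0) (fun J' => jet_connection j' k J' *m jet_tangent J').
    by apply: smooth_at_mulmx; [exact: smooth_at_jet_connection|exact: smooth_at_jet_tangent].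
  have sA := pull _ _ (smooth_at_jet_tangent (jet_truncate J0)).
  apply: (@smooth_at_tangent_part _ _ _ (fun J => jet_tangent (jet_truncate J))
    (fun J => jet_metric (jet_truncate J)) (fun J => jet_differential (jet_truncate J))) => //.
  + exact: pull _ _ (smooth_at_jet_metric _).
  + exact: pull _ _ (smooth_at_jet_differential reg).
  + by case: reg.
  apply: smooth_at_add; first exact: smooth_at_total_derive_mx.
  apply: (pull _ (fun J => jet_christoffel J (row i' (jet_tangent J))
           (jet_connection j' k J *m jet_tangent J))).
  apply: smooth_at_jet_christoffel => //; first exact: jet_metric_unit.
  exact: smooth_at_row_jet_tangent.
by apply: smooth_at_sub.
Qed.

End Rules.
End JetRules.

Section RulesCompute.
Context {R : realType} {m : nat}.
Context {M : manifold R m.+2} {g : lorentz_metric M} (V : lightlike g).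
Variables (c : mchart V) (d : mchart M).
Hypotheses (ac : atlas c) (ad : atlas d).
Local Notation iota := (@incl _ _ _ _ V).
Local Notation phi := (loc c d iota).

Lemma jet_tangent_jets q x : dom c x -> dom d (incl x) ->
  jet_tangent (jets c d q.+1 x) = jac c d iota x.
Proof.
move=> xc xd; apply/row_matrixP => i; rewrite [LHS]rowK jacE.
rewrite /jet_embedding /jets /= row_jet (derive_wordE (s := [:: i])) //=.
rewrite [RHS]row_jacobian //.
exact: smooth_at_differentiable (smooth_at_embedding ac ad xc xd).
Qed.

Lemma jet_metric_jets q x : dom d (incl x) ->
  jet_metric (jets c d q x) = gram g d (incl x).
Proof.
move=> xd; rewrite /jet_metric /jet_gram /jets /= row_jet (derive_wordE (s := [::])) //=.
by rewrite mxvecK; have [_ _ _ _ ->] := atlas_chart ad.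
Qed.

Lemma jet_gram_derive_jets q x v : dom d (incl x) ->
  jet_gram_derive (jets c d q.+2 x) v = 'D_v (gram g d \o bwd d) (fwd d (incl x)).
Proof.
move=> xd; have dG := smooth_at_differentiable (smooth_at_gram (g := g) ad xd).
rewrite [RHS](derive_row _ dG); apply: eq_bigr => a _; congr (_ *: _).
rewrite /jet_gram /jets /= row_jet (derive_wordE (s := [:: a])) //=.
rewrite [X in vec_mx X](derive_linear (L := mxvec) _ _ dG); last exact: mxvec_continuous.
by rewrite mxvecK.
Qed.

Lemma jet_christoffel_jets q x a b : dom d (incl x) ->
  jet_christoffel (jets c d q.+2 x) a b = christoffel (g := g) d (fwd d (incl x)) a b.
Proof.
move=> xd; rewrite /jet_christoffel /christoffel jet_metric_jets //.
have [_ _ _ _ dK] := atlas_chart ad.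
congr (_ *m invmx _); last by rewrite /= dK.
by apply/rowP => k; rewrite !mxE !jet_gram_derive_jets.
Qed.

Lemma christoffel0l y b : christoffel (g := g) d y 0 b = 0.
Proof.
rewrite /christoffel; set r := (\row_k _).
suff -> : r = 0 by rewrite mul0mx.
apply/rowP => k; rewrite !mxE derive0 /bil.
by rewrite !mulmx0 !mul0mx !mxE addr0 subr0 mulr0.
Qed.

Section Invariant.
Variable f : V -> R.
Hypotheses (sf : smooth_function f) (rf : regular_levels f)
  (tf : transversal_levels f).
Variable q : nat.
Variable F : @jet_space R m q.+1 -> R.
Hypothesis fE : forall x, dom c x -> dom d (incl x) ->
  smooth_at (jets c d q.+1 x) F /\ f x = F (jets c d q.+1 x).

(** Near the point the invariant is the function [F] of the jets, so its partial
    derivatives are the total derivatives of [F]. *)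
Lemma jet_differential_jets x : dom c x -> dom d (incl x) ->
  jet_differential F (jets c d q.+2 x) = differential_col f c x.
Proof.
move=> xc xd; apply/colP => i; rewrite !mxE.
have [sF _] := fE xc xd.
rewrite -[LHS](total_deriveP ac ad i xc xd sF); apply: near_eq_derive.
have := near_domain ac ad xc xd; apply: filterS => u [bc _ bd] /=.
by have [_ ->] := fE bc bd.
Qed.

Lemma jet_regular_jets x : dom c x -> dom d (incl x) ->
  jet_regular F (jets c d q.+2 x).
Proof.
move=> xc xd; split.
  by rewrite jet_truncate_jets; have [] := fE xc xd.
rewrite jet_tangent_jets // jet_metric_jets // jet_differential_jets //.
exact: transversal_data_at.
Qed.

(** The isotropic vectors orthogonal to the screen and transversal to the tangent
    space are the multiples of the rational normal vector. *)
Lemma normalization_jets x : dom c x -> dom d (incl x) ->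
  normalization (level_distribution f) c d x =
  [set v | exists k, v = k *: jet_normal F (jets c d q.+2 x)].
Proof.
move=> xc xd; have [_ dat] := jet_regular_jets xc xd.
have P v := normal_vecP dat v.
rewrite jet_tangent_jets // jet_metric_jets // jet_differential_jets // in P.
rewrite /jet_normal jet_tangent_jets // jet_metric_jets // jet_differential_jets //.
rewrite /normalization level_distributionE //.
by apply/seteqP; split=> v /= /P.
Qed.

(** The tangential component exists and is unique for every ambient vector. *)
Lemma induced_connection_jets X Y u : cod c u -> dom d (incl (bwd c u)) ->
  induced_connection (level_distribution f) c d X Y u =
  jet_tangent_part F (jets c d q.+2 (bwd c u)) (levi_civita c d X Y u).
Proof.
move=> uc ud; have [bc fb] := codP (atlas_chart ac) uc.
have [_ dat] := jet_regular_jets bc ud.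
rewrite /induced_connection (normalization_jets bc ud).
have JE : 'J phi u = jet_tangent (jets c d q.+2 (bwd c u)).
  by rewrite (jet_tangent_jets _ bc ud) jacE fb.
apply: xget_unique.
  by rewrite /= JE; exact: (tangent_partP dat _ _).2 erefl.
by move=> t /=; rewrite JE => /(tangent_partP dat).
Qed.

(** For constant fields, the derivative of the image of the [k]-th field is a second
    partial derivative of the embedding. *)
Lemma connection_jets i k u : cod c u -> dom d (incl (bwd c u)) ->
  induced_connection (level_distribution f) c d (coord_field i) (coord_field k) u =
  jet_connection F i k (jets c d q.+2 (bwd c u)).
Proof.
move=> uc ud; have [bc fb] := codP (atlas_chart ac) uc.
rewrite (induced_connection_jets _ _ uc ud) /jet_connection; congr (jet_tangent_part _ _ _).
have JE : 'J phi u = jet_tangent (jets c d q.+2 (bwd c u)).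
  by rewrite (jet_tangent_jets _ bc ud) jacE fb.
rewrite /levi_civita JE (jet_christoffel_jets _ _ _ ud) -!rowE.
have -> : phi u = fwd d (incl (bwd c u)) by [].
congr (_ + _).
rewrite /jet_embedding /jets /= row_jet fb (derive_wordE (s := [:: i; k])) //=.
apply: near_eq_derive.
have := near_domain ac ad bc ud; rewrite fb; apply: filterS => w [wc wb wd].
have dw := smooth_at_differentiable (smooth_at_embedding ac ad wc wd).
by rewrite wb in dw; rewrite -rowE (row_jacobian _ dw).
Qed.

Lemma second_jets i j k x : dom c x -> dom d (incl x) ->
  induced_connection (level_distribution f) c d (coord_field i)
    (induced_connection (level_distribution f) c d (coord_field j) (coord_field k))
    (fwd c x) = jet_second_derivative F i j k (jets c d q.+3 x).
Proof.
move=> xc xd; have ic := atlas_chart ac; have [_ _ _ _ cK] := ic.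
have cx : cod c (fwd c x) by exists x.
have cd : dom d (incl (bwd c (fwd c x))) by rewrite cK.
rewrite (induced_connection_jets _ _ cx cd) /jet_second_derivative jet_truncate_jets (cK x xc).
congr (jet_tangent_part _ _ _).
have JE : 'J phi (fwd c x) = jet_tangent (jets c d q.+2 x).
  by rewrite (jet_tangent_jets _ xc xd) jacE.
rewrite /levi_civita (connection_jets _ _ cx cd) (cK x xc) JE.
rewrite (jet_christoffel_jets _ _ _ xd) -rowE (phiE _ ac xc).
have reg := jet_regular_jets xc xd.
have sY : smooth_at (jets c d q.+2 x)
    (fun j' => jet_connection F j k j' *m jet_tangent j').
  by apply: smooth_at_mulmx; [exact: smooth_at_jet_connection|exact: smooth_at_jet_tangent].
rewrite -(total_deriveP ac ad i xc xd sY).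
apply: (congr1 (fun z => z + _)).
apply: near_eq_derive; have := near_domain ac ad xc xd.
apply: filterS => w [wc wb wd].
have cw : cod c w by exists (bwd c w).
by rewrite (connection_jets _ _ cw wd) (jet_tangent_jets _ wc wd) jacE wb.
Qed.

Lemma curvature_jets i j k x : dom c x -> dom d (incl x) ->
  curvature (induced_connection (level_distribution f) c d)
    (coord_field i) (coord_field j) (coord_field k) (fwd c x) =
  jet_curvature F i j k (jets c d q.+3 x).
Proof.
move=> xc xd; have ic := atlas_chart ac; have [_ _ _ _ cK] := ic.
have cx : cod c (fwd c x) by exists x.
have cd : dom d (incl (bwd c (fwd c x))) by rewrite cK.
rewrite /curvature !(second_jets _ _ _ xc xd) /jet_curvature.
have -> : lie_bracket (coord_field i) (coord_field j) = fun=> (0 : 'rV[R]_m.+1).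
  by apply/funext => u; rewrite /lie_bracket !derive_cst subrr.
rewrite (induced_connection_jets _ _ cx cd) (cK x xc).
have -> : levi_civita c d (fun=> 0) (coord_field k) (fwd c x) = 0.
  by rewrite /levi_civita derive0 mul0mx christoffel0l addr0.
suff -> : jet_tangent_part F (jets c d q.+2 x) 0 = 0 by rewrite subr0.
rewrite /jet_tangent_part /tangent_part /bil !mul0mx mxE scale0r subr0.
by rewrite !mul0mx.
Qed.

End Invariant.
End RulesCompute.

Theorem theorem5 (R : realType) (m : nat)
    (K : hypersurface_class R m) (J : frame_function R m)
    (J_invariant : absolute_invariant K J)
    (J_smooth : forall M g (V : lightlike g), K M g V ->
       forall e : V -> @frame R m M, frame_field e ->
         smooth_function (along J e))
    (J_levels : forall M g (V : lightlike g), K M g V ->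
       forall e : V -> @frame R m M, frame_field e ->
         regular_levels (along J e) /\ transversal_levels (along J e)) :
  ((forall M g (V : lightlike g), K M g V ->
      forall e : V -> @frame R m M, frame_field e ->
        screen_distribution (generated J e)) /\
   invariant_distribution K (generated J)) /\
  (intrinsic_function K J -> intrinsic_distribution K (generated J)) /\
  (forall p : nat, (0 < p)%N -> function_order K p J ->
     normalization_order K p.+1 (generated J) /\
     curvature_order K p.+2 (generated J)).
Proof.
split; [split|split].
- move=> M g V KV e fe; have [rf tf] := J_levels M g V KV e fe.
  exact: screen_level_distribution (J_smooth M g V KV e fe) rf tf.
- move=> M g V KV e e' fe fe' c x ac xc.
  rewrite /generated; congr (level_distribution _ c x).
  by apply/funext => y; apply: J_invariant (fe y) (fe' y).
- move=> intr M g V M' g' V' Phi psi KV KV' iso e e' fe fe' c c' x ac ac' xc xc'.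
  have [rf tf] := J_levels M g V KV e fe.
  have [rf' tf'] := J_levels M' g' V' KV' e' fe'.
  have [_ dpsi _ _] := iso.
  apply: (level_distribution_image (J_smooth M g V KV e fe) rf tf
    (J_smooth M' g' V' KV' e' fe') rf' tf' dpsi) => //.
  apply/funext => y; apply: (intr _ _ _ _ _ _ _ _ KV KV' iso) (fe y) (fe' (psi y)).
(* Jets of order [p] contain the jet of the metric of order [p.-1], whence the
   form [q.+1] of the order. *)
case=> // q _ Jorder.
have key (M : manifold R m.+2) (d : mchart M) : atlas d ->
    exists F : jet_space q.+1 -> R,
    forall (g : lorentz_metric M) (V : lightlike g), K M g V ->
    forall c : mchart V, atlas c -> forall e : V -> @frame R m M, frame_field e ->
    forall x, dom c x -> dom d (incl x) ->
      smooth_at (jets c d q.+1 x) F /\ along J e x = F (jets c d q.+1 x).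
  move=> ad; have [F FP] := Jorder M d ad; exists F => g V KV c ac e fe x xc xd.
  have [sF JF] := FP g V KV c x ac xc xd; split=> //.
  exact: JF (fe x).
split=> [M d ad|i j k M d ad]; have [F FP] := key M d ad.
  exists (jet_normal F) => g V KV c x ac xc xd; split.
    (* Smoothness is claimed without any frame field, but transversality is
       known only through one. *)
    have [e fe] := exists_frame_field V.
    have [rf tf] := J_levels M g V KV e fe.
    apply: smooth_at_jet_normal.
    exact: (jet_regular_jets ac ad (J_smooth M g V KV e fe) rf tf (FP g V KV c ac e fe)).
  move=> e fe; have [rf tf] := J_levels M g V KV e fe.
  have sf := J_smooth M g V KV e fe.
  have FE := FP g V KV c ac e fe.
  split.
    have [_ dat] := jet_regular_jets ac ad sf rf tf FE xc xd.
    exact: normal_vec_neq0 dat.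
  rewrite /generated (normalization_jets ac ad sf rf tf FE xc xd).
  by apply/seteqP; split=> v /= [t]; [move=> ->; exists t|move=> _ <-; exists t].
exists (jet_curvature F i j k) => g V KV c x ac xc xd; split.
  have [e fe] := exists_frame_field V.
  have [rf tf] := J_levels M g V KV e fe.
  apply: smooth_at_jet_curvature; rewrite jet_truncate_jets.
  exact: (jet_regular_jets ac ad (J_smooth M g V KV e fe) rf tf (FP g V KV c ac e fe)).
move=> e fe; have [rf tf] := J_levels M g V KV e fe.
exact: (curvature_jets ac ad (J_smooth M g V KV e fe) rf tf (FP g V KV c ac e fe)).
Qed.
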